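(* Let $d\ge 2$ be an odd integer with $d\not\equiv 1\pmod 3$. Then a very generic foliation of degree $d$ on the complex projective plane $\mathbb{P}^2_{\mathbb{C}}$ has no algebraic solutions; that is, there is a countable union $S$ of proper Zariski closed subsets of the space of foliations of degree $d$ on $\mathbb{P}^2_{\mathbb{C}}$ such that every foliation of degree $d$ not lying in $S$ has no invariant algebraic curve.
   Context: A foliation of degree $d$ on $\mathbb{P}^2_{\mathbb{C}}$ is given, up to $\mathbb{C}^*$, by a nonzero section $\omega\in H^0(\mathbb{P}^2_{\mathbb{C}},\Omega^1(d+2))$ with finite zero locus; equivalently $\omega=A\,dx+B\,dy+C\,dz$ on $\mathbb{A}^3_{\mathbb{C}}$ with $A,B,C$ homogeneous of degree $d+1$, $xA+yB+zC=0$, and finitely many common zeros in $\mathbb{P}^2_{\mathbb{C}}$. The space of foliations of degree $d$ is the corresponding Zariski open subset of $\mathbb{P}(H^0(\mathbb{P}^2_{\mathbb{C}},\Omega^1(d+2)))$. A reduced curve $C=\{F=0\}$ ($F$ homogeneous) is invariant by the foliation if $dF\wedge\omega=F\Theta$ for some homogeneous polynomial $2$-form $\Theta$ on $\mathbb{A}^3_{\mathbb{C}}$. An algebraic solution is an (irreducible) invariant algebraic curve. *)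

(* Defs.v *)
(* The complex field is R[i], for R : realType. *)
From HB Require Import structures.
From mathcomp Require Export all_boot all_order all_algebra.
From mathcomp Require Export mpoly.
From mathcomp Require Export classical_sets cardinality.
From mathcomp Require Export reals complex.

Set Implicit Arguments.
Unset Strict Implicit.
Unset Printing Implicit Defensive.

Import Order.TTheory GRing.Theory Num.Theory.
Local Open Scope classical_set_scope.
Local Open Scope ring_scope.

Section Projective.
Variable K : fieldType.

(* Points of P(V) are the lines <[v]> of V, so a subset of P(V) is a set of
   subspaces all of whose members are of the form <[v]> with v != 0. *)
Definition proj_set (V : vectType K) (A : set V) : set {vspace V} :=
  [set <[v]>%VS | v in [set v : V | v != 0 /\ A v]].

(* The choice of the basis used for the coordinates is immaterial. *)
Definition zariski_closed (V : vectType K) (Z : set {vspace V}) : Prop :=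
  exists2 E : set {mpoly K[\dim {:V}]},
    forall P, E P -> exists k : nat, P \is k.-homog &
    Z = proj_set [set v : V | forall P, E P ->
                    P.@[fun i => coord (vbasis {:V}) i v] = 0].

(* Closed for the topology induced on the subset X of P(V). *)
Definition zariski_closed_in (V : vectType K) (X Z : set {vspace V}) : Prop :=
  exists2 Y : set {vspace V}, zariski_closed Y & Z = X `&` Y.

End Projective.

Section Foliations.
Variable K : numClosedFieldType.

(* A dx + B dy + C dz with A, B, C homogeneous of degree k. *)
Definition homog_oneform (k : nat) := {ffun 'I_3 -> dhomog 3 K k}.

Lemma contraction_homog k (w : homog_oneform k) :
  \sum_i 'X_i * (w i : {mpoly K[3]}) \is k.+1.-homog.
Proof.
apply: rpred_sum => i _; apply: (@dhomogM _ _ _ 1 _ k).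
  by rewrite dhomogX; apply/eqP/mdeg1.
exact: dhomog_is_dhomog.
Qed.

(* Contraction x A + y B + z C with the radial vector field. *)
Definition contraction k (w : homog_oneform k) : dhomog 3 K k.+1 :=
  DHomog (contraction_homog w).

Lemma contraction_is_linear k : linear (@contraction k).
Proof.
move=> a u v; apply/val_inj => /=.
rewrite scaler_sumr -big_split /=; apply: eq_bigr => i _.
by rewrite !ffunE /= mulrDr -scalerAr.
Qed.

HB.instance Definition _ k :=
  GRing.isLinear.Build K (homog_oneform k) (dhomog 3 K k.+1) _
    (@contraction k) (@contraction_is_linear k).

(* H^0(P^2, Omega^1(d+2)). *)
Definition twisted_oneforms (d : nat) : {vspace homog_oneform d.+1} :=
  lker (linfun (@contraction d.+1)).

Lemma mem_twisted_oneforms d (w : homog_oneform d.+1) :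
  (w \in twisted_oneforms d) =
  (\sum_i 'X_i * (w i : {mpoly K[3]}) == 0).
Proof. by rewrite memv_ker lfunE /= -val_eqE. Qed.

Definition H0 (d : nat) : vectType K := subvs_of (twisted_oneforms d).

Definition component d (w : H0 d) (i : 'I_3) : {mpoly K[3]} := vsval w i.

Definition singular_locus d (w : H0 d) : set {vspace 'rV[K]_3} :=
  proj_set [set p : 'rV[K]_3 | forall i, (component w i).@[p 0] = 0].

Definition defines_foliation d (w : H0 d) : Prop :=
  w != 0 /\ finite_set (singular_locus w).

Definition foliations (d : nat) : set {vspace H0 d} :=
  proj_set [set w : H0 d | defines_foliation w].

(* The 2-form \sum_(i < j) T i j dx_i /\ dx_j is encoded by the
   antisymmetric matrix T. *)
Definition twoform_mx (T : 'M[{mpoly K[3]}]_3) : Prop := T^T = - T.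

Definition wedge (a b : 'I_3 -> {mpoly K[3]}) : 'M[{mpoly K[3]}]_3 :=
  \matrix_(i, j) (a i * b j - a j * b i).

Definition differential (F : {mpoly K[3]}) (i : 'I_3) : {mpoly K[3]} :=
  F^`M(i).

Definition reduced_curve (F : {mpoly K[3]}) : Prop :=
  [/\ F != 0,
      exists2 e : nat, (0 < e)%N & F \is e.-homog &
      forall G H : {mpoly K[3]}, F = G ^+ 2 * H -> G \is a GRing.unit].

Definition invariant_curve d (w : H0 d) (F : {mpoly K[3]}) : Prop :=
  reduced_curve F /\
  exists T : 'M[{mpoly K[3]}]_3,
    [/\ twoform_mx T,
        exists k : nat, forall i j, T i j \is k.-homog &
        wedge (differential F) (component w) = F *: T].

End Foliations.

Arguments foliations K d : clear implicits.

(* Main.v *)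
From HB Require Import structures.
Require Import Defs.
From mathcomp Require Import boolp perm cyclic separable cyclotomic.
From mathcomp Require Import ring zify.

Set Implicit Arguments.
Unset Strict Implicit.
Unset Printing Implicit Defensive.

Import Order.TTheory GRing.Theory Num.Theory.
Local Open Scope classical_set_scope.
Local Open Scope ring_scope.

(** The foliation of Jouanolou, given by the vector field [z^d dx + x^d dy + y^d dz],
    has no invariant curve.  Let [F] be an invariant curve of degree [e] with cofactor [L].
    The singular points are [(s, s^(d+1), 1)] with [s^N = 1], [N = d^2 + d + 1].
    The lowest order part of [F] at such a point is an eigenvector of the
    linearisation, whence [s L(s, s^(d+1), 1) = e - (b + c) + d (b zeta + c zeta^2)]
    with [zeta] a primitive cube root of unity and [b + c] the multiplicity of [F]
    at the point.  No monomial of [L] survives summation over [s], so the sum of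
    the multiplicities is [2 N e / (d + 2)].  But all singular points lie on the
    rational curve [y z^d = x^(d+1)] of degree [d + 1], which is not invariant;
    restricting [F] to it bounds this sum by [(d + 1) e], a contradiction.

    Elimination theory then yields, for every [e], a homogeneous polynomial on
    the space of 1-forms that vanishes at all forms with an invariant curve of
    degree [e] but not at the form of Jouanolou. *)

(** * Elimination *)

Section Elimination.
Variables (K : closedFieldType) (B : Type) (A : (B -> K) -> Prop).
Hypothesis A_cst : forall c, A (fun=> c).
Hypothesis A_add : forall f g, A f -> A g -> A (fun w => f w + g w).
Hypothesis A_mul : forall f g, A f -> A g -> A (fun w => f w * g w).

Local Notation fam := (B -> (nat -> K) -> K).

(** Forms of degree [k] in [y 0], ..., [y n.-1] with coefficients in [A], expanded in powers of the
    last variable. The recursion on [n] matches elimination, which removes the last variable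
    first. *)
Fixpoint form (n k : nat) (f : fam) : Prop :=
  if n is n'.+1 then
    exists2 g : nat -> fam, forall i, (i <= k)%N -> form n' (k - i) (g i) &
      forall w y, f w y = \sum_(i < k.+1) g i w y * y n' ^+ i
  else if k is 0 then exists2 c, A c & forall w y, f w y = c w
  else forall w y, f w y = 0.

Lemma form_ext n k f g : (forall w y, f w y = g w y) -> form n k f -> form n k g.
Proof.
move=> fg; case: n => [|n] /=.
  case: k => [|k]; last by move=> h w y; rewrite -fg.
  by case=> c Ac h; exists c => // w y; rewrite -fg.
by case=> h Ah e; exists h => // w y; rewrite -fg.
Qed.

Lemma form_base n c : A c -> form n 0 (fun w _ => c w).
Proof.
move=> Ac; elim: n => [|n IHn] /=; first by exists c.
exists (fun _ w _ => c w) => [i|w y]; first by rewrite leqn0 => /eqP->.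
by rewrite big_ord1 expr0 mulr1.
Qed.

Lemma form_cst n c : form n 0 (fun _ _ => c).
Proof. exact: (form_base n (A_cst c)). Qed.

Lemma form0 n k : form n k (fun _ _ => 0).
Proof.
elim: n k => [|n IHn] k /=; first by case: k => // ; exists (fun=> 0).
exists (fun _ _ _ => 0) => [i _|w y]; first exact: IHn.
by rewrite big1 // => i _; rewrite mul0r.
Qed.

Lemma form_var n i : (i < n)%N -> form n 1 (fun _ y => y i).
Proof.
elim: n => [|n IHn] //; rewrite ltnS leq_eqVlt => /orP[/eqP->|ltin] /=.
  exists (fun i _ _ => (i == 1)%:R) => [[|[|j]] _ //=|w y].
  - exact: form0.
  - exact: form_cst.
  by rewrite !big_ord_recl big_ord0 /= mul0r add0r mul1r addr0 expr1.
exists (fun j _ y => (j == 0)%:R * y i) => [[|[|j]] _ //=|w y].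
- by apply: (form_ext _ (IHn ltin)) => w y; rewrite mul1r.
- by apply: (form_ext _ (form0 n 0)) => w y; rewrite mul0r.
by rewrite !big_ord_recl big_ord0 /= !mul0r mul1r mulr1 !addr0.
Qed.

Lemma formD n k f g :
  form n k f -> form n k g -> form n k (fun w y => f w y + g w y).
Proof.
elim: n k f g => [|n IHn] k f g /=.
  case: k => [|k]; last by move=> hf hg w y; rewrite hf hg addr0.
  case=> c Ac hc [c' Ac' hc']; exists (fun w => c w + c' w); first exact: A_add.
  by move=> w y; rewrite hc hc'.
case=> a ha ea [b hb eb]; exists (fun i w y => a i w y + b i w y).
  by move=> i ik; apply: IHn; [apply: ha|apply: hb].
by move=> w y; rewrite ea eb -big_split; apply: eq_bigr => i _; rewrite mulrDl.
Qed.

Lemma form_sum n k (I : Type) (r : seq I) (P : pred I) (f : I -> fam) :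
  (forall i, P i -> form n k (f i)) ->
  form n k (fun w y => \sum_(i <- r | P i) f i w y).
Proof.
move=> hf; elim: r => [|i r IHr].
  by apply: (form_ext _ (form0 n k)) => w y; rewrite big_nil.
case Pi: (P i); last by apply: (form_ext _ IHr) => w y; rewrite big_cons Pi.
apply: (form_ext _ (formD (hf _ Pi) IHr)) => w y.
by rewrite big_cons Pi.
Qed.

Lemma formM n k l f g :
  form n k f -> form n l g -> form n (k + l) (fun w y => f w y * g w y).
Proof.
elim: n k l f g => [|n IHn] k l f g /=.
  case: k => [|k]; last by rewrite addSn => hf _ w y; rewrite hf mul0r.
  case: l => [|l]; last by rewrite addnS => _ hg w y; rewrite hg mulr0.
  case=> c Ac hc [c' Ac' hc']; exists (fun w => c w * c' w); first exact: A_mul.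
  by move=> w y; rewrite hc hc'.
case=> a ha ea [b hb eb].
exists (fun m w y => \sum_(i < k.+1) \sum_(j < l.+1 | (i + j == m)%N)
                       a i w y * b j w y).
  move=> m mkl; apply: form_sum => i _; apply: form_sum => j /eqP ijm.
  rewrite (_ : (k + l - m = (k - i) + (l - j))%N); last first.
    by rewrite -ijm; move: (ltn_ord i) (ltn_ord j); lia.
  by apply: IHn; [apply: ha; rewrite -ltnS|apply: hb; rewrite -ltnS].
move=> w y; rewrite ea eb big_distrlr /=.
under [RHS]eq_bigr do rewrite mulr_suml.
rewrite [RHS]exchange_big; apply: eq_bigr => i _ /=.
under [RHS]eq_bigr do rewrite mulr_suml.
rewrite (exchange_big_dep predT) //=; apply: eq_bigr => j _.
have ltij : (i + j < (k + l).+1)%N by move: (ltn_ord i) (ltn_ord j); lia.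
rewrite (big_pred1 (Ordinal ltij)); first by rewrite exprD mulrACA.
by move=> m; rewrite /= -val_eqE eq_sym.
Qed.

Lemma formZ n k c f : form n k f -> form n k (fun w y => c * f w y).
Proof. by move=> hf; have := formM (form_cst n c) hf; rewrite add0n. Qed.

Lemma form_prod n (I : Type) (r : seq I) (k : I -> nat) (f : I -> fam) :
  (forall i, form n (k i) (f i)) ->
  form n (\sum_(i <- r) k i)%N (fun w y => \prod_(i <- r) f i w y).
Proof.
move=> hf; elim: r => [|i r IHr].
  rewrite big_nil; apply: (form_ext _ (form_cst n 1)) => w y.
  by rewrite big_nil.
rewrite big_cons; apply: (form_ext _ (formM (hf i) IHr)) => w y.
by rewrite big_cons.
Qed.

(** Row weights [a] and column weights [b] give every term of the Leibniz expansion the same degree,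
    since a permutation only reorders the column weights. *)
Lemma form_det n N (a b : 'I_N -> nat) (M : B -> (nat -> K) -> 'M[K]_N) :
  (forall i j, (b j <= a i)%N -> form n (a i - b j) (fun w y => M w y i j)) ->
  (forall i j, (a i < b j)%N -> forall w y, M w y i j = 0) ->
  form n (\sum_i a i - \sum_j b j) (fun w y => \det (M w y)).
Proof.
move=> hM hM0; rewrite /determinant; apply: form_sum => s _; apply: formZ.
(* A negative weight difference means a zero entry, which kills the term; otherwise the truncated
   subtractions are exact. *)
case: (pickP (fun i => a i < b (s i))%N) => [i ai|bsa]; last first.
  have -> : (\sum_i a i - \sum_j b j = \sum_i (a i - b (s i)))%N.
    rewrite sumnB; last by move=> i _; rewrite leqNgt bsa.
    by congr (_ - _)%N; rewrite (reindex_inj (@perm_inj _ s)).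
  by apply: form_prod => i; apply: hM; rewrite leqNgt bsa.
apply: (form_ext _ (form0 n _)) => w y.
by rewrite (bigD1 i) //= hM0 // mul0r.
Qed.

Lemma form_local n k f w y z :
  form n k f -> (forall i, (i < n)%N -> y i = z i) -> f w y = f w z.
Proof.
elim: n k f => [|n IHn] k f /=.
  by case: k => [[c _ h]|k h] _; rewrite !h.
case=> g hg e yz; rewrite !e; apply: eq_bigr => i _.
rewrite yz //; congr (_ * _); apply: IHn (hg i _) _; first by rewrite -ltnS.
by move=> j jn; apply: yz; apply: ltnW.
Qed.

Lemma form_degree0 n f :
  form n 0 f -> exists2 c, A c & forall w y, f w y = c w.
Proof.
elim: n f => [|n IHn] f //= [g hg e].
have [c Ac hc] := IHn _ (hg 0%N isT).
by exists c => // w y; rewrite e big_ord1 expr0 mulr1 hc.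
Qed.

Lemma form_vanish n k f w y :
  (0 < k)%N -> form n k f -> (forall i, (i < n)%N -> y i = 0) -> f w y = 0.
Proof.
elim: n k f => [|n IHn] k f k0 /=; first by case: k k0.
case=> g hg e y0; rewrite e big1 // => i _.
have [->|i0] := posnP i; last by rewrite y0 // expr0n eqn0Ngt i0 mulr0.
rewrite (IHn (k - 0)%N) ?subn0 ?mul0r //; first by have := hg 0%N isT; rewrite subn0.
by move=> j jn; rewrite y0 // ltnW.
Qed.

(** Row shifts of two coefficient sequences of formal degree [k], lowest powers first; only [p] will
    have a leading coefficient known to be nonzero. *)
Definition sylvester k (p f : nat -> K) : 'M[K]_(k + k) :=
  \matrix_(i, j) (if (i < k)%N
    then if (i <= j <= i + k)%N then p (j - i)%N else 0
    else if (i - k <= j <= i)%N then f (j - (i - k))%N else 0).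

(** The vector of powers of the common root [x] is orthogonal to every row, and [0 < k] provides the
    entry 1 that makes it nonzero. *)
Lemma sylvester_root k (p f : nat -> K) x : (0 < k)%N ->
  \sum_(i < k.+1) p i * x ^+ i = 0 -> \sum_(i < k.+1) f i * x ^+ i = 0 ->
  \det (sylvester k p f) = 0.
Proof.
move=> k0 px fx.
have row (q : nat -> K) (a : nat) : (a < k)%N -> \sum_(i < k.+1) q i * x ^+ i = 0 ->
    \sum_(j < k + k) (if (a <= j <= a + k)%N then q (j - a)%N else 0) * x ^+ j = 0.
  move=> ak qx.
  rewrite -(big_mkord xpredT (fun j => (if (a <= j <= a + k)%N
             then q (j - a)%N else 0) * x ^+ j)).
  have e1 : (a <= a + k.+1 <= k + k)%N by lia.
  case/andP: e1 => e1 e2.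
  rewrite (big_cat_nat (leq0n _) e2) /= (big_cat_nat (leq0n a) e1) /=.
  rewrite big1_seq ?add0r => [|i]; last first.
    rewrite mem_index_iota /= => ia.
    by rewrite leqNgt ia mul0r.
  rewrite [X in _ + X]big1_seq ?addr0 => [|i]; last first.
    rewrite mem_index_iota /= => /andP[ia _].
    by rewrite [(i <= _)%N]leqNgt -addnS ia andbF mul0r.
  rewrite -{1}[a]add0n big_addn.
  transitivity (x ^+ a * \sum_(i < k.+1) q i * x ^+ i); last by rewrite qx mulr0.
  have -> : (a + k.+1 - a = k.+1)%N by rewrite addKn.
  rewrite big_mkord mulr_sumr; apply: eq_bigr => i _.
  by rewrite leq_addl addnC leq_add2l -ltnS ltn_ord /= addKn exprD mulrCA.
apply/eqP; rewrite -det_tr; apply/det0P.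
exists (\row_j x ^+ j).
  apply/eqP => /rowP /(_ (Ordinal (ltn_addr k k0))).
  by rewrite !mxE expr0 => /eqP; rewrite oner_eq0.
apply/rowP => i; rewrite !mxE.
under eq_bigr do rewrite !mxE mulrC.
case: (ltnP i k) => ik; first exact: row.
have e : (i - k + k = i)%N by rewrite subnK.
rewrite -[RHS](row f (i - k)%N) //; first by rewrite e.
by rewrite ltn_subLR ?ltn_ord.
Qed.

(** A left kernel vector is a pair [U], [V] of polynomials of degree below [k] with
    [U * P + V * F = 0]. If [P] and [F] were coprime, [P], of exact degree [k], would divide [V],
    forcing [V = 0] and then [U = 0]. *)
Lemma sylvester_det0 k (p f : nat -> K) : p k != 0 ->
  \det (sylvester k p f) = 0 ->
  exists2 x, \sum_(i < k.+1) p i * x ^+ i = 0 & \sum_(i < k.+1) f i * x ^+ i = 0.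
Proof.
move=> pk /eqP /det0P[v v0 vS].
pose P := \poly_(i < k.+1) p i; pose F := \poly_(i < k.+1) f i.
pose U := \poly_(i < k) (if insub i is Some j then v 0 j else 0).
pose V := \poly_(i < k) (if insub (k + i)%N is Some j then v 0 j else 0).
have sP : size P = k.+1 by rewrite size_poly_eq.
have UV : U * P + V * F = 0.
  apply/polyP => j; rewrite coef0 coefD.
  have [jk|kj] := ltnP j (k + k); last first.
    have sU : (size U <= k)%N := size_poly _ _.
    have sV : (size V <= k)%N := size_poly _ _.
    have sF : (size F <= k.+1)%N := size_poly _ _.
    have sUP := size_polyMleq U P; have sVF := size_polyMleq V F.
    have h1 : (size (U * P)%R <= j)%N.
      apply: leq_trans (leq_trans sUP _) kj.
      by rewrite -subn1 leq_subLR add1n -addnS sP leq_add.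
    have h2 : (size (V * F)%R <= j)%N.
      apply: leq_trans (leq_trans sVF _) kj.
      by rewrite -subn1 leq_subLR add1n -addnS leq_add.
    by rewrite (nth_default _ h1) (nth_default _ h2) addr0.
  move/rowP: vS => /(_ (Ordinal jk)); rewrite !mxE big_split_ord /= => vSj.
  rewrite -[RHS]vSj => {vSj}.
  have aux (q : nat -> K) (u : nat -> K) :
      ((\poly_(i < k) u i) * \poly_(i < k.+1) q i)`_j =
      \sum_(i < k) u i * (if (i <= j <= i + k)%N then q (j - i)%N else 0).
    rewrite coefM.
    transitivity (\sum_(i < k + k | (i < k)%N && (i <= j)%N)
                    u i * (\poly_(l < k.+1) q l)`_(j - i)).
      rewrite (big_ord_widen_cond (k + k)%N xpredT
        (fun i => (\poly_(i < k) u i)`_i * (\poly_(i < k.+1) q i)`_(j - i))) //.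
      rewrite [LHS]big_mkcond [RHS]big_mkcond; apply: eq_bigr => i _ /=.
      rewrite ltnS coef_poly; case: (i < k)%N; case: (i <= j)%N => //=.
      by rewrite mul0r.
    rewrite [RHS](big_ord_widen_cond (k + k)%N xpredT
      (fun i => u i * (if (i <= j <= i + k)%N then q (j - i)%N else 0))) ?leq_addr //.
    rewrite [LHS]big_mkcond [RHS]big_mkcond; apply: eq_bigr => i _ /=.
    rewrite coef_poly ltnS leq_subLR; case: (i < k)%N; case: (i <= j)%N => //=.
    by rewrite mulr0.
  rewrite /U /V /P /F !aux; congr (_ + _); apply: eq_bigr => i _; rewrite !mxE /=.
    rewrite ltn_ord insubT /=; first by rewrite ltn_addr.
    by move=> h; congr (v 0 _ * _); apply: val_inj.
  rewrite ltnNge leq_addr /= addKn insubT /=; first by rewrite ltn_add2l.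
  move=> h; congr (v 0 _ * _); first exact: val_inj.
  by rewrite addnC.
have [cop|ncop] := boolP (coprimep P F).
  have PV : P %| V.
    rewrite -(Gauss_dvdpl V cop); apply/dvdpP; exists (- U).
    by apply/eqP; rewrite mulNr -addr_eq0 addrC UV.
  have V0 : V = 0.
    apply/eqP/negPn/negP => /dvdp_leq /(_ PV); rewrite sP ltnNge.
    by rewrite size_poly.
  have U0 : U = 0.
    by apply/eqP; move/eqP: UV; rewrite V0 mul0r addr0 mulf_eq0 -[P == 0]size_poly_eq0 sP orbF.
  case/eqP: v0; apply/rowP => i; rewrite mxE -(splitK i).
  case: (split i) => j /=.
    move/polyP: U0 => /(_ j); rewrite coef_poly ltn_ord coef0.
    rewrite insubT /=; first by rewrite ltn_addr.
    by move=> h vj; rewrite -[RHS]vj; congr (v _ _); apply: val_inj.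
  move/polyP: V0 => /(_ j); rewrite coef_poly ltn_ord coef0.
  rewrite insubT /=; first by rewrite ltn_add2l.
  by move=> h vj; rewrite -[RHS]vj; congr (v _ _); apply: val_inj.
have /closed_rootP[x] : size (gcdp P F) != 1%N by [].
rewrite root_gcd => /andP[/rootP px /rootP fx].
by exists x; rewrite -horner_poly.
Qed.


Inductive span (S : fam -> Prop) : fam -> Prop :=
| span_gen f : S f -> span S f
| span_comb f g c : span S f -> span S g ->
    span S (fun w y => f w y + c * g w y).

(** For all but finitely many [t], the combination [f + t g] is nonzero at each given point where
    [f] or [g] is nonzero, so the points are treated one at a time. *)
Lemma span_avoid (S : fam -> Prop) w (u : K -> nat -> K) (rs : seq K) f0 :
  span S f0 -> (forall x, x \in rs -> exists2 f, span S f & f w (u x) != 0) ->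
  exists2 f, span S f & forall x, x \in rs -> f w (u x) != 0.
Proof.
move=> Sf0; elim: rs => [|x rs IHrs] h; first by exists f0.
have [y yrs|f Sf fP] := IHrs; first by apply: h; rewrite inE yrs orbT.
have [g Sg gx] := h _ (mem_head x rs).
pose P := \prod_(y <- x :: rs) ((f w (u y))%:P + (g w (u y))%:P * 'X).
have P0 : P != 0.
  rewrite prodf_seq_neq0; apply/allP => y yrs /=.
  apply/eqP => /polyP e; move: (e 0%N) (e 1%N).
  rewrite !coefD !coefCM !coefX !coefC ?coef0 /= mulr0 mulr1 addr0 add0r.
  move: yrs; rewrite inE => /orP[/eqP-> _|/fP + e0 _]; first by move/eqP: gx.
  by rewrite e0 eqxx.
have [t] := closed_nonrootP _ P0.
rewrite /root horner_prod prodf_seq_neq0 => /allP tP.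
exists (fun w y => f w y + t * g w y); first exact: span_comb.
by move=> y /tP; rewrite !hornerE mulrC.
Qed.

(** Induction on [n]: some form [p] contains a pure power of the last variable with nonzero
    coefficient at [w0], and the resultants of [p] with the span of [S] eliminate that variable. *)
Theorem elimination n k (S : fam -> Prop) w0 : (0 < k)%N ->
  (forall f, S f -> form n k f) ->
  (forall y, (exists2 i, (i < n)%N & y i != 0) -> exists2 f, S f & f w0 y != 0) ->
  exists2 Q, A Q & Q w0 != 0 /\
    forall w y, (exists2 i, (i < n)%N & y i != 0) ->
      (forall f, S f -> f w y = 0) -> Q w = 0.
Proof.
elim: n k S => [|n IHn] k S k0 Sform S0.
  by exists (fun=> 1) => //; split=> [|w y []//]; rewrite oner_eq0.
have spanF f : span S f -> form n.+1 k f.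
  elim=> [|{}f g c _ hf _ hg]; first exact: Sform.
  by apply: formD => //; apply: formZ.
have span0 w y f : (forall f, S f -> f w y = 0) -> span S f -> f w y = 0.
  by move=> h; elim=> [|{}f g c _ -> _ ->]; [exact: h|rewrite mulr0 addr0].
pose en : nat -> K := fun i => (i == n)%:R.
(* Evaluation at the last coordinate point singles out the coefficient [c] of the pure power of
   [y n]. *)
have [|p Sp pen] := S0 en.
  by exists n => //; rewrite /en eqxx oner_eq0.
have [gp gpF gpE] := Sform _ Sp.
have [|c Ac cE] := form_degree0 (f := gp k) (n := n).
  by have := gpF _ (leqnn k); rewrite subnn.
have pE w y : (forall i, (i < n)%N -> y i = 0) -> p w y = c w * y n ^+ k.
  move=> y0; rewrite gpE big_ord_recr /= cE big1 ?add0r // => i _.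
  by rewrite (form_vanish w _ (gpF i _) y0) ?mul0r // ?subn_gt0 // ltnW.
have c0 : c w0 != 0.
  move: pen; rewrite pE => [|i /ltn_eqF]; last by rewrite /en => ->.
  by rewrite mulf_eq0 negb_or => /andP[].
pose res g : fam := fun w y => \det (sylvester k (fun i => gp i w y) (fun i => g i w y)).
pose S' (h : fam) := exists f g, [/\ span S f,
   forall i, (i <= k)%N -> form n (k - i) (g i),
   forall w y, f w y = \sum_(i < k.+1) g i w y * y n ^+ i & h = res g].
(* In the rows of [p] the coefficient of index [j - i] has degree [k - (j - i)], that is
   [k + i - j]; in the rows of [f] the shift by [k] turns this into [i - j]. *)
pose a (i : 'I_(k + k)) := ((if (i < k)%N then k else 0) + i)%N.
pose k' := (\sum_i a i - \sum_(j < k + k) j)%N.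
have k'0 : (0 < k')%N.
  rewrite /k' big_split addnK (bigD1 (Ordinal (ltn_addr k k0))) //= k0.
  by rewrite ltn_addr.
have S'form h : S' h -> form n k' h.
  case=> f [g [_ gF gE ->]]; apply: form_det => i j; rewrite /a.
    case: (ltnP i k) => ik ji.
      case: (boolP (i <= j <= i + k)%N) => [/andP[ij jk]|nij].
        have -> : (k + i - j = k - (j - i))%N by lia.
        apply: (form_ext (f := gp (j - i)%N)); last by apply: gpF; lia.
        by move=> w y; rewrite mxE ik ij jk.
      apply: (form_ext _ (form0 n _)) => w y.
      by rewrite mxE ik (negPf nij).
    case: (boolP (i - k <= j <= i)%N) => [/andP[ij jk]|nij].
      have -> : (0 + i - j = k - (j - (i - k)))%N by lia.
      apply: (form_ext (f := g (j - (i - k))%N)); last by apply: gF; lia.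
      by move=> w y; rewrite mxE ltnNge ik ij jk.
    apply: (form_ext _ (form0 n _)) => w y.
    by rewrite mxE ltnNge ik (negPf nij).
  move=> aj w y; rewrite mxE; move: aj.
  by case: (ltnP i k) => ik aj; case: ifP => // /andP[]; lia.
have upd y x : exists2 z : nat -> K, z n = x & forall i, (i < n)%N -> z i = y i.
  exists (fun i => if i == n then x else y i); first by rewrite eqxx.
  by move=> i /ltn_eqF->.
have [|Q AQ [Q0 QP]] := IHn k' S' k'0 S'form.
  (* If all resultants vanished at [(w0, y)], take a member of the span that is nonzero at every
     root of [p] above [y]: its resultant with [p] would still yield a common root. *)
  move=> y [m mn ym]; apply: contrapT => noh.
  have noh' h : S' h -> h w0 y = 0.
    by move=> S'h; apply/eqP/negPn/negP => hy; apply: noh; exists h.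
  pose P := \poly_(i < k.+1) gp i w0 y.
  have P0 : P != 0.
    by rewrite -size_poly_eq0 size_poly_eq //= cE.
  have [rs Prs] := closed_field_poly_normal P.
  pose u x : nat -> K := fun i => if i == n then x else y i.
  have un x : u x n = x by rewrite /u eqxx.
  have ui x i : (i < n)%N -> u x i = y i by rewrite /u => /ltn_eqF->.
  have [x xrs|f Sf fP] := span_avoid (w := w0) (u := u) (rs := rs) (span_gen Sp).
    have [|f Sf fx] := S0 (u x); last by exists f => //; apply: span_gen.
    by exists m; [rewrite ltnW|rewrite ui].
  have [g gF gE] := spanF _ Sf.
  have [||x xp xf] := @sylvester_det0 k (fun i => gp i w0 y) (fun i => g i w0 y).
  - by rewrite cE.
  - by have := noh' (res g); apply; exists f, g; split.
  have xrs : x \in rs.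
    rewrite -root_prod_XsubC; suff: root P x.
      by rewrite Prs rootZ // lead_coef_eq0.
    by rewrite /root horner_poly xp.
  move/negP: (fP _ xrs); apply; apply/eqP.
  rewrite gE un -[RHS]xf; apply: eq_bigr => i _; congr (_ * _).
  by apply: form_local (gF i _) _; [rewrite -ltnS|apply: ui].
(* Where [c w] is nonzero, [p] excludes solutions having only the last coordinate nonzero, so [y]
   stays nontrivial in the first [n] variables. *)
exists (fun w => c w * Q w); first exact: A_mul.
split=> [|w y [m mn ym] Sy]; first by rewrite mulf_neq0.
have [->|cw] := eqVneq (c w) 0; first by rewrite mul0r.
rewrite (QP w y) ?mulr0 //.
  apply: contrapT => noi.
  have y0 i : (i < n)%N -> y i = 0.
    by move=> ni; apply/eqP/negPn/negP => yi; apply: noi; exists i.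
  have := Sy _ Sp; rewrite pE // => /eqP; rewrite mulf_eq0 (negPf cw) /=.
  rewrite expf_eq0 k0 /= => /eqP yn.
  move: mn ym; rewrite ltnS leq_eqVlt => /orP[/eqP->|/y0->]; last by rewrite eqxx.
  by rewrite yn eqxx.
move=> _ [f [g [Sf gF gE ->]]]; apply: (sylvester_root (x := y n)) => //.
  by rewrite -gpE; apply: Sy.
by rewrite -gE; apply: span0.
Qed.

End Elimination.

(** * Elimination for kernels of linear families of matrices *)

Section LinearElimination.
Variables (K : closedFieldType) (B : Type) (A : (B -> K) -> Prop).
Hypothesis A_cst : forall c, A (fun=> c).
Hypothesis A_add : forall f g, A f -> A g -> A (fun w => f w + g w).
Hypothesis A_mul : forall f g, A f -> A g -> A (fun w => f w * g w).

(** A nonzero left kernel makes all maximal minors vanish, and these minors are forms of degree [r]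
    in [y]. *)
Theorem elimination_kernel n r s (M : 'I_n -> B -> 'M[K]_(r, s)) w0 :
  (0 < r)%N -> (forall i k l, A (fun w => M i w k l)) ->
  (forall (y : 'I_n -> K) (u : 'rV_r), (exists i, y i != 0) ->
     u *m \sum_i y i *: M i w0 = 0 -> u = 0) ->
  exists2 Q, A Q & Q w0 != 0 /\
    forall w (y : 'I_n -> K) (u : 'rV_r), (exists i, y i != 0) -> u != 0 ->
      u *m \sum_i y i *: M i w = 0 -> Q w = 0.
Proof.
move=> r0 AM M0.
pose Mt w (y : nat -> K) := \sum_(i < n) y i *: M i w.
pose S f := exists h : 'I_r -> 'I_s, f = fun w y => \det (colsub h (Mt w y)).
(* This is [r], written as in [form_det] with row weights 1 and column weights 0. *)
pose k := (\sum_(i < r) 1 - \sum_(j < r) 0)%N.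
have [|f [h ->]|y [i ni yi]|Q AQ [Q0 QP]] :=
  @elimination K B A A_cst A_add A_mul n k S w0.
- by rewrite /k sum_nat_const card_ord muln1 big1 // subn0.
- apply: form_det => // i j _.
  apply: (form_ext (f := fun w y => \sum_(l < n) y l * M l w i (h j))).
    by move=> w y; rewrite mxE summxE; apply: eq_bigr => l _; rewrite mxE.
  apply: form_sum => // l _; apply: (@formM _ _ _ A_cst A_add A_mul n 1 0).
    exact: form_var.
  exact: form_base.
(* At [w0] the rows are independent, so some choice of [r] columns has nonzero determinant. *)
- have fr : row_full (Mt w0 y)^T.
    rewrite /row_full mxrank_tr; change (row_free (Mt w0 y)).
    apply/inj_row_free => u; apply: (M0 (fun i => y i)).
    by exists (Ordinal ni).
  exists (fun w y => \det (colsub (fullrankfun fr) (Mt w y))).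
    by exists (fullrankfun fr).
  have := fullrowsub_unit fr.
  by rewrite unitmxE unitfE -det_tr trmx_mxsub trmxK.
exists Q => //; split=> // w y u [i yi] u0 uM.
pose z j := if insub j is Some i then y i else 0.
have zE (j : 'I_n) : z j = y j by rewrite /z valK.
apply: (QP w z); first by exists i => //; rewrite zE.
move=> _ [h ->]; apply/eqP/det0P; exists u => //.
rewrite mulmx_colsub.
have -> : Mt w z = \sum_i y i *: M i w.
  by apply: eq_bigr => j _; rewrite zE.
by rewrite uM; apply/rowP => j; rewrite !mxE.
Qed.
End LinearElimination.

(** * Polynomial functions on a vector space and homogeneous components *)

Section PolynomialFunctions.
Variables (K : closedFieldType) (V : vectType K).

Definition polyfun (f : V -> K) := exists P : {mpoly K[\dim {:V}]},
  forall w, f w = P.@[fun i => coord (vbasis {:V}) i w].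

Lemma polyfun_cst c : polyfun (fun=> c).
Proof. by exists c%:MP => w; rewrite mevalC. Qed.

Lemma polyfunD f g : polyfun f -> polyfun g -> polyfun (fun w => f w + g w).
Proof. by case=> P hP [Q hQ]; exists (P + Q) => w; rewrite mevalD hP hQ. Qed.

Lemma polyfunM f g : polyfun f -> polyfun g -> polyfun (fun w => f w * g w).
Proof. by case=> P hP [Q hQ]; exists (P * Q) => w; rewrite mevalM hP hQ. Qed.

Lemma polyfun_linear (f : V -> K) : scalar f -> polyfun f.
Proof.
move=> flin; pose F : {scalar V} := HB.pack f (GRing.isLinear.Build K V K _ f flin).
exists (\sum_(i < \dim {:V}) F (vbasis {:V})`_i *: 'X_i) => w.
rewrite raddf_sum /= -[f]/(F : V -> K) {1}(coord_vbasis (memvf w)) linear_sum.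
by apply: eq_bigr => i _; rewrite mevalZ mevalXU linearZ /= mulrC.
Qed.
End PolynomialFunctions.

Lemma meval_homog (K : comNzRingType) n k (p : {mpoly K[n]}) c v :
  p \is k.-homog -> p.@[fun i => c * v i] = c ^+ k * p.@[v].
Proof.
move=> /dhomogP hp; rewrite !mevalE mulr_sumr; apply: eq_big_seq => m /hp mk.
rewrite mulrCA; congr (_ * _).
under eq_bigr do rewrite exprMn.
rewrite big_split /=; congr (_ * _).
by rewrite prodrXr -mdegE mk.
Qed.

(** Along the multiples of a point of [T], [P] is a polynomial in the scaling factor with infinitely
    many zeros, so each homogeneous component vanishes separately. One of them is nonzero at
    [v0]. *)
Lemma homogeneous_component (K : closedFieldType) n (P : {mpoly K[n]})
    (T : ('I_n -> K) -> Prop) v0 :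
  (forall c v, c != 0 -> T v -> T (fun i => c * v i)) ->
  (forall v, T v -> P.@[v] = 0) -> P.@[v0] != 0 ->
  exists k (Q : {mpoly K[n]}), [/\ Q \is k.-homog,
    forall v, T v -> Q.@[v] = 0 & Q.@[v0] != 0].
Proof.
move=> Tc TP P0.
have PE := pihomog_partitionE (mf := mdeg) (leqnn (msize P)).
have [k Pk] : exists k : 'I_(msize P), (pihomog mdeg k P).@[v0] != 0.
  apply: contrapT => h; move/eqP: P0; apply; rewrite PE raddf_sum big1 //= => i _.
  by apply/eqP/negPn/negP => hi; apply: h; exists i.
exists k, (pihomog mdeg k P); split=> // [|v Tv]; first exact: pihomogP.
pose R := \poly_(i < msize P) (pihomog mdeg i P).@[v].
have R0 : R = 0.
  apply/eqP/negPn/negP => R0.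
  (* The factor ['X] ensures that the chosen scalar is nonzero. *)
  have /closed_nonrootP[c] : 'X * R != 0 by rewrite mulf_neq0 ?polyX_eq0.
  rewrite /root hornerM hornerX mulf_eq0 negb_or => /andP[c0].
  rewrite horner_poly.
  under eq_bigr do rewrite mulrC -(meval_homog _ _ (pihomogP _ _ _)).
  by rewrite -raddf_sum -PE /= (TP _ (Tc _ _ c0 Tv)) eqxx.
by move/polyP: R0 => /(_ k); rewrite coef_poly ltn_ord coef0.
Qed.

(** * Derivations of polynomial substitutions *)

Section MmapLemmas.
Variables (K : comNzRingType) (n : nat).

(** The chain rule passes to products by the Leibniz rule, hence holds on monomials. It will be used
    for both partial derivatives on [{poly {poly K}}]. *)
Lemma mmap_derivation (S : comNzRingType) (c : {rmorphism K -> S})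
    (h : 'I_n -> S) (delta : S -> S) (p : {mpoly K[n]}) :
  (forall a b, delta (a + b) = delta a + delta b) ->
  (forall a b, delta (a * b) = delta a * b + a * delta b) ->
  (forall k, delta (c k) = 0) ->
  delta (mmap c h p) = \sum_i delta (h i) * mmap c h p^`M(i).
Proof.
move=> dD dM dC.
pose D (q : {mpoly K[n]}) :=
  delta (mmap c h q) = \sum_i delta (h i) * mmap c h q^`M(i).
have DC k : D k%:MP.
  rewrite /D mmapC dC big1 // => i _.
  by rewrite mderivC raddf0 mulr0.
have DM q r : D q -> D r -> D (q * r).
  rewrite /D => hq hr; rewrite rmorphM dM hq hr mulr_suml mulr_sumr -big_split.
  by apply: eq_bigr => i _; rewrite mderivM mmapD !rmorphM /=; ring.
have DX i : D 'X_i.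
  rewrite /D mmapX mmap1U (bigD1 i) //= big1 ?addr0 => [|j ji].
    by rewrite mderivX mnm1E eqxx scale1r -[X in 'X_[(X - _)]]add0m addmK mpolyX0 rmorph1 mulr1.
  by rewrite mderivX mnm1E eq_sym (negPf ji) scale0r raddf0 mulr0.
elim/mpolyind: p => [|k m p _ _ IHp]; first by have := DC 0; rewrite /D mpolyC0.
have Dm : D 'X_[m].
  rewrite mpolyXE_id; apply: (big_ind D) => [|//|i _]; first by have := DC 1; rewrite mpolyC1.
  elim: (m i) => [|j IHj]; first by rewrite expr0; have := DC 1; rewrite mpolyC1.
  by rewrite exprS; apply: DM.
have := DM _ _ (DC k) Dm; rewrite /D mul_mpolyC => Dkm.
rewrite mmapD dD Dkm IHp -big_split; apply: eq_bigr => i _.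
by rewrite mderivD mmapD mulrDr.
Qed.

Lemma euler_identity e (p : {mpoly K[n]}) :
  p \is e.-homog -> \sum_i 'X_i * p^`M(i) = p *+ e.
Proof.
move=> /dhomogP hp; rewrite {2}[p]mpolyE -sumrMnl.
transitivity (\sum_i \sum_(m <- msupp p) p@_m *: 'X_[m] *+ m i).
  apply: eq_bigr => i _; rewrite {1}[p]mpolyE raddf_sum mulr_sumr.
  apply: eq_bigr => m _; rewrite /= mderivZ mderivX -!scalerAr.
  have [->|mi] := posnP (m i); first by rewrite scale0r scaler0 mulr0n.
  by rewrite -mpolyXD addmC submK ?lep1mP -?lt0n // scaler_nat scalerMnr.
rewrite exchange_big; apply: eq_big_seq => m /hp <- /=.
by rewrite sumrMnr mdegE.
Qed.

Lemma rmorph_mmap (S S' : comNzRingType) (c : {rmorphism K -> S})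
    (c' : {rmorphism K -> S'}) (g : {rmorphism S -> S'}) (h : 'I_n -> S) p :
  (forall k, g (c k) = c' k) -> g (mmap c h p) = mmap c' (fun i => g (h i)) p.
Proof.
move=> gc; rewrite /mmap rmorph_sum; apply: eq_bigr => m _.
rewrite rmorphM gc /mmap1 rmorph_prod; congr (_ * _).
by apply: eq_bigr => i _; rewrite rmorphXn.
Qed.

Lemma eq_mmap (S : comNzRingType) (c : {rmorphism K -> S}) (h h' : 'I_n -> S) p :
  h =1 h' -> mmap c h p = mmap c h' p.
Proof.
move=> hh; apply: eq_bigr => m _; congr (_ * _).
by apply: eq_bigr => i _; rewrite hh.
Qed.

Lemma mmap_comp (S : comNzRingType) (c : {rmorphism K -> S}) k (h : 'I_k -> S)
    (lq : n.-tuple {mpoly K[k]}) (p : {mpoly K[n]}) :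
  mmap c h (p \mPo lq) = mmap c (fun i => mmap c h (tnth lq i)) p.
Proof. by apply: rmorph_mmap => a /=; rewrite mmapC. Qed.

End MmapLemmas.

Lemma expr1D_order2 (S : comNzRingType) (u : S) d :
  exists r, (1 + u) ^+ d = 1 + u *+ d + u ^+ 2 * r.
Proof.
elim: d => [|d [r IHd]]; first by exists 0; rewrite expr0 mulr0n mulr0 !addr0.
exists (r + u * r + d%:R); rewrite exprS IHd -[in RHS](mulr_natr u d.+1) -(mulr_natr u d).
by rewrite -natr1; ring.
Qed.

(* The hypotheses relate [f = F (h)] and its derivatives, where [h] is the affine
   chart in which the singular point is blown up; [Bi] stands for the (rescaled)
   pullback of the [i]-th partial derivative of [F]. *)
Lemma blowup_identity (S : comNzRingType) (t a Z B0 B1 B2 f ft fa L rx ry rz e d : S) :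
  Z ^+ 2 + Z + 1 = 0 ->
  ft = (a + 1) * B0 + (Z ^+ 2 * a + Z) * B1 + (Z * a + Z ^+ 2) * B2 ->
  fa = t * (B0 + Z ^+ 2 * B1 + Z * B2) ->
  e * f = (1 + t * (a + 1)) * B0 + (1 + t * (Z ^+ 2 * a + Z)) * B1
          + (1 + t * (Z * a + Z ^+ 2)) * B2 ->
  (1 + d * t * (Z * a + Z ^+ 2) + t ^+ 2 * rz) * B0
    + (1 + d * t * (a + 1) + t ^+ 2 * rx) * B1
    + (1 + d * t * (Z ^+ 2 * a + Z) + t ^+ 2 * ry) * B2 = L * f ->
  3%:R * (e * f - t * ft + d * (Z * a * fa + Z ^+ 2 * (t * ft - a * fa)))
  + t * (rz * (t * (e * f - t * ft) + fa + (t * ft - a * fa))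
       + rx * (t * (e * f - t * ft) + Z * fa + Z ^+ 2 * (t * ft - a * fa))
       + ry * (t * (e * f - t * ft) + Z ^+ 2 * fa + Z * (t * ft - a * fa)))
  = 3%:R * (L * f).
Proof.
move=> Z0 -> -> -> <-.
(* The combinations of [B0], [B1], [B2] form a discrete Fourier transform of order 3: [hd] says that
   the linearised field is diagonal in it, and [h0], [h1], [h2] invert it. Each difference is an
   explicit multiple of [Z ^+ 2 + Z + 1]. *)
have hd : Z * a * (B0 + Z ^+ 2 * B1 + Z * B2) + Z ^+ 2 * (B0 + Z * B1 + Z ^+ 2 * B2)
    = (Z * a + Z ^+ 2) * B0 + (a + 1) * B1 + (Z ^+ 2 * a + Z) * B2.
  apply: subr0_eq; rewrite -[RHS](mulr0 ((Z - 1) * ((a + 1) * B1 + Z * B2))) -Z0.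
  ring.
have h0 : B0 + B1 + B2 + (B0 + Z ^+ 2 * B1 + Z * B2) + (B0 + Z * B1 + Z ^+ 2 * B2)
    = 3%:R * B0.
  by apply: subr0_eq; rewrite -[RHS](mulr0 (B1 + B2)) -Z0; ring.
have h1 : B0 + B1 + B2 + Z * (B0 + Z ^+ 2 * B1 + Z * B2)
    + Z ^+ 2 * (B0 + Z * B1 + Z ^+ 2 * B2) = 3%:R * B1.
  apply: subr0_eq.
  rewrite -[RHS](mulr0 (B0 + 2%:R * (Z - 1) * B1 + (Z ^+ 2 - Z + 1) * B2)) -Z0; ring.
have h2 : B0 + B1 + B2 + Z ^+ 2 * (B0 + Z ^+ 2 * B1 + Z * B2)
    + Z * (B0 + Z * B1 + Z ^+ 2 * B2) = 3%:R * B2.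
  apply: subr0_eq.
  rewrite -[RHS](mulr0 (B0 + (Z ^+ 2 - Z + 1) * B1 + 2%:R * (Z - 1) * B2)) -Z0; ring.
transitivity (3%:R * (B0 + B1 + B2) + 3%:R * (d * t) * 
  ((Z * a + Z ^+ 2) * B0 + (a + 1) * B1 + (Z ^+ 2 * a + Z) * B2)
  + t ^+ 2 * (rz * (3%:R * B0) + rx * (3%:R * B1) + ry * (3%:R * B2))); last by ring.
by rewrite -hd -h0 -h1 -h2; ring.
Qed.

Local Notation i0 := (@Ordinal 3 0 isT).
Local Notation i1 := (@Ordinal 3 1 isT).
Local Notation i2 := (@Ordinal 3 2 isT).

Lemma ord3P (P : 'I_3 -> Prop) : P i0 -> P i1 -> P i2 -> forall i, P i.
Proof.
move=> P0 P1 P2 [[|[|[|//]]] lti].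
- by rewrite (_ : Ordinal lti = i0) //; apply: val_inj.
- by rewrite (_ : Ordinal lti = i1) //; apply: val_inj.
- by rewrite (_ : Ordinal lti = i2) //; apply: val_inj.
Qed.

Lemma big_ord3 (R : Type) (idx : R) (op : Monoid.law idx) (f : 'I_3 -> R) :
  \big[op/idx]_i f i = op (op (f i0) (f i1)) (f i2).
Proof.
rewrite !big_ord_recl big_ord0 Monoid.mulm1 Monoid.mulmA.
by congr (op (op (f _) (f _)) (f _)); apply: val_inj.
Qed.

Definition triple (T : Type) (a b c : T) : 'I_3 -> T := tnth [tuple a; b; c].

(** * Polynomials in two variables and the blow-up of a point *)

Section InnerDerivative.
Variable K : comNzRingType.

(** With [{poly {poly K}}] read as polynomials in [t] over [K[a]], this is the derivative in [a],
    while [deriv] is the one in [t]. *)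
Definition inner_deriv (p : {poly {poly K}}) : {poly {poly K}} := map_poly deriv p.

Lemma inner_derivD p q : inner_deriv (p + q) = inner_deriv p + inner_deriv q.
Proof. exact: raddfD. Qed.

Lemma inner_derivM p q :
  inner_deriv (p * q) = inner_deriv p * q + p * inner_deriv q.
Proof.
apply/polyP => i; rewrite coefD coef_map !coefM raddf_sum -big_split.
by apply: eq_bigr => j _; rewrite /= derivM !coef_map.
Qed.

Lemma inner_derivC p : inner_deriv p%:P = (p^`())%:P.
Proof. exact: map_polyC. Qed.

Lemma inner_derivXn n : inner_deriv 'X^n = 0.
Proof.
apply/polyP => i; rewrite coef_map coefXn coef0 /=.
by case: eqP => _; rewrite ?derivC ?raddf0 // -polyC1 derivC.
Qed.

Lemma inner_derivX : inner_deriv 'X = 0.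
Proof. by rewrite -['X]expr1 inner_derivXn. Qed.
End InnerDerivative.

Section Blowup.
Variable K : fieldType.

Definition cst2 : {rmorphism K -> {poly {poly K}}} := polyC \o polyC.

Local Notation t := ('X : {poly {poly K}}).
Local Notation a := ('X%:P : {poly {poly K}}).

(** The chart [(1, t a, t)] blows up the point [(1, 0, 0)]: the exponent of [t] records the order in
    the last two variables, that of [a] the part due to the first of them. *)
Lemma coef_blowup (G : {mpoly K[3]}) i j :
  (mmap cst2 (triple 1 (t * a) t) G)`_i`_j =
  \sum_(u <- msupp G) G@_u * ((u i1 + u i2 == i)%N && (u i1 == j))%:R.
Proof.
rewrite /mmap coef_sum coef_sum; apply: eq_bigr => u _.
rewrite /mmap1 big_ord3 /triple !(tnth_nth 0) /= expr1n mul1r.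
have -> : (t * a) ^+ u i1 * t ^+ u i2 = ('X^(u i1))%:P * t ^+ (u i1 + u i2)%N.
  by rewrite exprMn -rmorphXn exprD; ring.
rewrite mulrA -rmorphM coefCM coefXn -mulrA coefCM; congr (_ * _).
rewrite [i == _]eq_sym; case: eqP => _ /=; last by rewrite mulr0 coef0.
by rewrite mulr1 coefXn eq_sym.
Qed.

(** Homogeneity recovers the exponent of the first variable, so distinct monomials of [G] have
    distinct images. *)
Lemma coef_blowup_homog e (G : {mpoly K[3]}) u : G \is e.-homog -> u \in msupp G ->
  (mmap cst2 (triple 1 (t * a) t) G)`_(u i1 + u i2)`_(u i1) = G@_u.
Proof.
move=> /dhomogP Ge uG; rewrite coef_blowup (bigD1_seq u) ?msupp_uniq //=.
rewrite !eqxx mulr1 big_seq_cond big1 ?addr0 // => v /andP[vG vu].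
case: eqP => [e2|_]; last by rewrite mulr0.
case: eqP => [e1|_]; last by rewrite mulr0.
have Gu : mdeg u = e := Ge _ uG; have Gv : mdeg v = e := Ge _ vG.
case/eqP: vu; apply/mnmP; move: Gu Gv; rewrite !mdegE !big_ord3 /= => Gu Gv.
by apply: ord3P; lia.
Qed.
End Blowup.

(** * Eigencoordinates at a singular point *)

Lemma dft3_inverse (S : comNzRingType) (third Z s q x y z x' y' z' : S) :
  3%:R * third = 1 -> Z ^+ 2 + Z + 1 = 0 ->
  x = s * x' -> y = q * y' -> z = z' ->
  let u0 := third * (x' + y' + z') in
  let u1 := third * (x' + Z * y' + Z ^+ 2 * z') in
  let u2 := third * (x' + Z ^+ 2 * y' + Z * z') in
  [/\ s * (u0 + u1 + u2) = x, q * (u0 + Z ^+ 2 * u1 + Z * u2) = y &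
      u0 + Z * u1 + Z ^+ 2 * u2 = z].
Proof.
move=> h3 hZ -> -> ->; split; apply: subr0_eq.
- transitivity (s * third * (y' + z') * (Z ^+ 2 + Z + 1)
    + s * x' * (3%:R * third - 1)); first by ring.
  by rewrite hZ h3; ring.
- transitivity (q * third * (x' + 2%:R * (Z - 1) * y' + (Z ^+ 2 - Z + 1) * z')
    * (Z ^+ 2 + Z + 1) + q * y' * (3%:R * third - 1)); first by ring.
  by rewrite hZ h3; ring.
- transitivity (third * (x' + (Z ^+ 2 - Z + 1) * y' + 2%:R * (Z - 1) * z')
    * (Z ^+ 2 + Z + 1) + z' * (3%:R * third - 1)); first by ring.
  by rewrite hZ h3; ring.
Qed.

Section LocalAnalysis.
Variables (K : fieldType) (d : nat) (s zeta : K).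
Hypothesis s_root : s ^+ (d ^ 2 + d + 1) = 1.
Hypothesis zeta_root : zeta ^+ 2 + zeta + 1 = 0.
Hypothesis three_neq0 : 3%:R != 0 :> K.

Local Notation q := (s ^+ d.+1).
Local Notation z := (zeta%:MP : {mpoly K[3]}).

(** Takes [(1, 0, 0)] to the singular point [(s, q, 1)] and the other two basis vectors to
    eigenvectors of [s] times the linearised field, with eigenvalues [d zeta] and [d zeta^2]. *)
Definition eigen_chart : 3.-tuple {mpoly K[3]} :=
  [tuple s%:MP * ('X_i0 + 'X_i1 + 'X_i2);
         q%:MP * ('X_i0 + z ^+ 2 * 'X_i1 + z * 'X_i2);
         'X_i0 + z * 'X_i1 + z ^+ 2 * 'X_i2].

(** The inverse linear substitution; its last two forms cut out the singular point. *)
Definition eigen_coord : 3.-tuple {mpoly K[3]} :=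
  let x := s^-1%:MP * 'X_i0 in let y := q^-1%:MP * 'X_i1 in
  [tuple (3%:R^-1)%:MP * (x + y + 'X_i2);
         (3%:R^-1)%:MP * (x + z * y + z ^+ 2 * 'X_i2);
         (3%:R^-1)%:MP * (x + z ^+ 2 * y + z * 'X_i2)].

Lemma s_neq0 : s != 0.
Proof.
apply/eqP => s0; move: s_root; rewrite s0 addn1 exprS mul0r => /esym/eqP.
by rewrite oner_eq0.
Qed.

Lemma zeta_rootC (S : comNzRingType) (c : {rmorphism K -> S}) :
  c zeta ^+ 2 + c zeta + 1 = 0.
Proof. by rewrite -rmorphXn -(rmorph1 c) -!rmorphD zeta_root rmorph0. Qed.

Lemma eigen_chartK (F : {mpoly K[3]}) : (F \mPo eigen_chart) \mPo eigen_coord = F.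
Proof.
rewrite {1}/comp_mpoly mmap_comp -[RHS]comp_mpoly_id; apply: eq_mmap.
have h3 : 3%:R * (3%:R^-1)%:MP = 1 :> {mpoly K[3]}.
  by rewrite -(rmorph_nat (@mpolyC 3 K)) -rmorphM mulfV // rmorph1.
have [||||] := @dft3_inverse _ _ z s%:MP q%:MP 'X_i0 'X_i1 'X_i2
   (s^-1%:MP * 'X_i0) (q^-1%:MP * 'X_i1) 'X_i2 h3.
- exact: (zeta_rootC (@mpolyC 3 K)).
- by rewrite mulrA -rmorphM mulfV ?s_neq0 // rmorph1 mul1r.
- by rewrite mulrA -rmorphM mulfV ?expf_neq0 ?s_neq0 // rmorph1 mul1r.
- by [].
move=> e0 e1 e2; apply: ord3P; rewrite tnth_mktuple /eigen_chart !(tnth_nth 0) /=.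
- rewrite !(rmorphM, rmorphD) /= !mmapC !mmapX !mmap1U !(tnth_nth 0); exact: e0.
- rewrite !(rmorphM, rmorphD, rmorphXn) /= !mmapC !mmapX !mmap1U !(tnth_nth 0); rewrite -rmorphXn; exact: e1.
- rewrite !(rmorphM, rmorphD, rmorphXn) /= !mmapC !mmapX !mmap1U !(tnth_nth 0); exact: e2.
Qed.

Lemma eigen_chart_homog e (F : {mpoly K[3]}) :
  F \is e.-homog -> F \mPo eigen_chart \is e.-homog.
Proof.
move=> /dhomogP Fe; rewrite comp_mpolyEX; rewrite big_seq; apply: rpred_sum => m mF.
apply: rpredZ; rewrite comp_mpolyX big_ord3 -(Fe _ mF : mdeg m = e) mdegE big_ord3 /=.
have hX i : ('X_i : {mpoly K[3]}) \is 1.-homog by rewrite dhomogX; apply/eqP/mdeg1.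
have hC (c : K) (p : {mpoly K[3]}) : p \is 1.-homog -> c%:MP * p \is 1.-homog.
  by move=> hp; rewrite mul_mpolyC rpredZ.
have hL i : tnth eigen_chart i \is 1.-homog.
  move: i; apply: ord3P; rewrite (tnth_nth 0) /= -?rmorphXn.
  - by rewrite hC // !rpredD.
  - by rewrite hC // !rpredD // hC.
  - by rewrite !rpredD // hC.
have hLn i k : tnth eigen_chart i ^+ k \is k.-homog.
  by rewrite -[k in k.-homog]mul1n dhomogMn.
by apply: dhomogM => //; apply: dhomogM.
Qed.
End LocalAnalysis.

(** * Darboux polynomials of the vector field of Jouanolou *)

Definition jouanolou_darboux (K : fieldType) d (F L : {mpoly K[3]}) :=
  'X_i2 ^+ d * F^`M(i0) + 'X_i0 ^+ d * F^`M(i1) + 'X_i1 ^+ d * F^`M(i2) = L * F.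

(** * The cofactor at a singular point *)

Section LocalCofactor.
Variables (K : fieldType) (d : nat) (s zeta : K).
Hypothesis s_root : s ^+ (d ^ 2 + d + 1) = 1.
Hypothesis zeta_root : zeta ^+ 2 + zeta + 1 = 0.
Hypothesis three_neq0 : 3%:R != 0 :> K.
Variables (e : nat) (F L : {mpoly K[3]}).
Hypothesis F0 : F != 0.
Hypothesis Fe : F \is e.-homog.
Hypothesis FL : jouanolou_darboux d F L.

Local Notation t := ('X : {poly {poly K}}).
Local Notation a := ('X%:P : {poly {poly K}}).
Local Notation Z := (cst2 K zeta).
Let G := F \mPo eigen_chart d s zeta.
Let f := mmap (cst2 K) (triple 1 (t * a) t) G.

Let h := triple (cst2 K s * (1 + t * (a + 1)))
  (cst2 K (s ^+ d.+1) * (1 + t * (Z ^+ 2 * a + Z))) (1 + t * (Z * a + Z ^+ 2)).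

Lemma blowup_pullback p :
  mmap (cst2 K) (triple 1 (t * a) t) (p \mPo eigen_chart d s zeta) = mmap (cst2 K) h p.
Proof.
rewrite mmap_comp; apply: eq_mmap; apply: ord3P; rewrite /h /triple !(tnth_nth 0) /=.
- rewrite !(rmorphM, rmorphD) /= !mmapC !mmapX !mmap1U !(tnth_nth 0) /=.
  by rewrite /cst2 /=; ring.
- rewrite !(rmorphM, rmorphD) /= !mmapC !mmapX !mmap1U !(tnth_nth 0) /=.
  by rewrite /cst2 /=; ring.
- rewrite !(rmorphM, rmorphD) /= !mmapC !mmapX !mmap1U !(tnth_nth 0) /=.
  by rewrite /cst2 /=; ring.
Qed.

Lemma cst2_inner_deriv c : inner_deriv (cst2 K c) = 0.
Proof. by rewrite /cst2 /= inner_derivC derivC. Qed.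

Lemma cst2_deriv c : (cst2 K c)^`() = 0.
Proof. exact: derivC. Qed.

(** [blowup_identity] is divided by the power of [t] in [f] and evaluated on the exceptional divisor
    [t = 0]; only the lowest order part of [F] at the singular point remains. *)
Lemma blowup_equation :
  let lam := s * L.@[triple s (s ^+ d.+1) 1] in
  exists m g, [/\ f = t ^+ m * g, g`_0 != 0 &
    (e%:R - m%:R) *: g`_0
    + d%:R *: (zeta *: ('X * (g`_0)^`())
               + zeta ^+ 2 *: (m%:R *: g`_0 - 'X * (g`_0)^`()))
    = lam *: g`_0].
Proof.
move=> lam.
have G0 : G != 0.
  apply: contraNneq F0 => G0; rewrite -(eigen_chartK s_root zeta_root three_neq0 F).
  by rewrite -/G G0 raddf0.
have Ge : G \is e.-homog by apply: eigen_chart_homog.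
have f0 : f != 0.
  apply: contraTneq (mlead_supp G0) => f0.
  apply/negP => /(coef_blowup_homog Ge)/eqP; rewrite -/f f0 !coef0 eq_sym.
  by rewrite mleadc_eq0 (negPf G0).
(* The exponent [m] is the multiplicity of [F] at the singular point. *)
have [m [g [gnz fE]]] : exists m g, ~~ root g 0 /\ f = t ^+ m * g.
  have [m [g /implyP/(_ f0) gnz fE]] := multiplicity_XsubC f 0.
  by exists m, g; split=> //; rewrite fE subr0 mulrC.
have g0 : g`_0 != 0 by move: gnz; rewrite /root horner_coef0.
exists m, g; split=> //.
pose A i := mmap (cst2 K) h F^`M(i).
have fh : f = mmap (cst2 K) h F by apply: blowup_pullback.
have [rx hrx] := expr1D_order2 (t * (a + 1)) d.
have [ry hry] := expr1D_order2 (t * (Z ^+ 2 * a + Z)) d.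
have [rz hrz] := expr1D_order2 (t * (Z * a + Z ^+ 2)) d.
(* Rescaling by the coordinates of the singular point absorbs [s] and [q], so that the point is
   treated like [(1, 1, 1)]. *)
pose B0 := cst2 K s * A i0; pose B1 := cst2 K (s ^+ d.+1) * A i1; pose B2 := A i2.
have E1 : f^`() = (a + 1) * B0 + (Z ^+ 2 * a + Z) * B1 + (Z * a + Z ^+ 2) * B2.
  rewrite fh (mmap_derivation h F (@derivD _) (@derivM _) cst2_deriv) big_ord3 /=.
  rewrite -/(A i0) -/(A i1) -/(A i2) /h /triple !(tnth_nth 0) /=.
  rewrite !(derivM, derivD, derivX, derivC, cst2_deriv, expr2) /B0 /B1 /B2.
  ring.
have E2 : inner_deriv f = t * (B0 + Z ^+ 2 * B1 + Z * B2).
  rewrite fh (mmap_derivation h F (@inner_derivD _) (@inner_derivM _) cst2_inner_deriv).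
  rewrite big_ord3 /= -/(A i0) -/(A i1) -/(A i2) /h /triple !(tnth_nth 0) /=.
  rewrite !(inner_derivM, inner_derivD, inner_derivX, inner_derivC, cst2_inner_deriv, expr2).
  rewrite !(derivX, derivC) ?polyC1 ?polyC0 /B0 /B1 /B2.
  ring.
have E3 : e%:R * f = (1 + t * (a + 1)) * B0 + (1 + t * (Z ^+ 2 * a + Z)) * B1
          + (1 + t * (Z * a + Z ^+ 2)) * B2.
  have := congr1 (mmap (cst2 K) h) (euler_identity Fe).
  rewrite big_ord3 /= !(rmorphD, rmorphM, rmorphMn) /= -fh -mulr_natl => <-.
  rewrite !mmapX !mmap1U -/(A i0) -/(A i1) -/(A i2) /h /triple !(tnth_nth 0) /=.
  by rewrite /B0 /B1 /B2; ring.
have E4 : (1 + d%:R * t * (Z * a + Z ^+ 2) + t ^+ 2 * ((Z * a + Z ^+ 2) ^+ 2 * rz)) * B0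
    + (1 + d%:R * t * (a + 1) + t ^+ 2 * ((a + 1) ^+ 2 * rx)) * B1
    + (1 + d%:R * t * (Z ^+ 2 * a + Z) + t ^+ 2 * ((Z ^+ 2 * a + Z) ^+ 2 * ry)) * B2
    = (cst2 K s * mmap (cst2 K) h L) * f.
  have EL : h i2 ^+ d * A i0 + h i0 ^+ d * A i1 + h i1 ^+ d * A i2
      = mmap (cst2 K) h L * f.
    have := congr1 (mmap (cst2 K) h) FL.
    by rewrite fh /A !(rmorphD, rmorphM, rmorphXn) /= !mmapX !mmap1U.
  transitivity (cst2 K s * (mmap (cst2 K) h L * f)); last by rewrite mulrA.
  rewrite -EL /h /triple !(tnth_nth 0).
  rewrite [nth _ _ i0]/= [nth _ _ i1]/= [nth _ _ i2]/=.
  rewrite !exprMn hrx hry hrz.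
  (* Since [s ^+ (d ^ 2 + d + 1) = 1], also [s q^d = 1]: multiplied by [s], the field at the
     singular point is [(s, q, 1)] itself. *)
  have sd : cst2 K s * cst2 K (s ^+ d.+1) ^+ d = 1.
    rewrite -rmorphXn -rmorphM -exprM -exprS.
    by rewrite (_ : (d.+1 * d).+1 = (d ^ 2 + d + 1)%N) ?s_root ?rmorph1 //; lia.
  have sd1 : cst2 K (s ^+ d.+1) = cst2 K s * cst2 K s ^+ d.
    by rewrite -rmorphXn -rmorphM -exprS.
  rewrite [RHS](_ : _ = (1 + (t * (Z * a + Z ^+ 2)) *+ d + (t * (Z * a + Z ^+ 2)) ^+ 2 * rz) * B0
    + (cst2 K s * cst2 K s ^+ d) * ((1 + (t * (a + 1)) *+ d + (t * (a + 1)) ^+ 2 * rx) * A i1)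
    + (cst2 K s * cst2 K (s ^+ d.+1) ^+ d)
      * ((1 + (t * (Z ^+ 2 * a + Z)) *+ d + (t * (Z ^+ 2 * a + Z)) ^+ 2 * ry) * B2)); last first.
    by rewrite /B0 /B2; ring.
  by rewrite sd -sd1 /B1 -!(mulr_natl (t * _) d); ring.
have {E1 E2 E3 E4} := blowup_identity (zeta_rootC zeta_root (cst2 K)) E1 E2 E3 E4.
have fE1 : t * f^`() = t ^+ m * (m%:R * g + t * g^`()).
  rewrite fE derivM derivXn; case: (m) => [|k] /=; first by rewrite expr0 !mulr0n; ring.
  by rewrite -(mulr_natl (t ^+ k)) exprS; ring.
have fE2 : inner_deriv f = t ^+ m * inner_deriv g.
  by rewrite fE inner_derivM inner_derivXn mul0r add0r.
rewrite fE1 fE2 fE.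
set Lh := mmap _ _ _; set gt := g^`(); set ga := inner_deriv g => ident.
(* [R] collects what carries a further factor [t] and so disappears at [t = 0]. *)
pose R := 3%:R * (d%:R * Z ^+ 2 - 1) * gt
  + ((Z * a + Z ^+ 2) ^+ 2 * rz * (t * (e%:R * g - (m%:R * g + t * gt)) + ga
        + (m%:R * g + t * gt - a * ga))
     + (a + 1) ^+ 2 * rx * (t * (e%:R * g - (m%:R * g + t * gt)) + Z * ga
        + Z ^+ 2 * (m%:R * g + t * gt - a * ga))
     + (Z ^+ 2 * a + Z) ^+ 2 * ry * (t * (e%:R * g - (m%:R * g + t * gt)) + Z ^+ 2 * ga
        + Z * (m%:R * g + t * gt - a * ga))).
have {}ident : t ^+ m * (3%:R * ((e%:R - m%:R) * g
      + d%:R * (Z * (a * ga) + Z ^+ 2 * (m%:R * g - a * ga))) + t * R)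
    = t ^+ m * (3%:R * (cst2 K s * Lh * g)).
  rewrite [RHS](_ : _ = 3%:R * (cst2 K s * Lh * (t ^+ m * g))); last by ring.
  by rewrite -ident /R; ring.
have {}ident := mulfI (expf_neq0 m (negbT (polyX_eq0 _))) ident.
have pit : horner_eval 0 t = 0 by rewrite /horner_eval hornerX.
have pia : horner_eval 0 a = 'X by rewrite /horner_eval hornerC.
have pic c : horner_eval 0 (cst2 K c) = c%:P by rewrite /horner_eval hornerC.
have pig p : horner_eval 0 p = p`_0 by rewrite /horner_eval horner_coef0.
have piga : horner_eval 0 ga = (g`_0)^`() by rewrite pig coef_map.
have piL : horner_eval 0 Lh = (L.@[triple s (s ^+ d.+1) 1])%:P.
  rewrite (rmorph_mmap (c' := @polyC K)) => [|k]; last exact: pic.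
  rewrite (rmorph_mmap (c := idfun) (c' := @polyC K)) //; apply: eq_mmap.
  apply: ord3P; rewrite /h /triple !(tnth_nth 0) /=.
  - by rewrite rmorphM rmorphD rmorphM /= pit mul0r addr0 rmorph1 mulr1 pic.
  - by rewrite rmorphM rmorphD rmorphM /= pit mul0r addr0 rmorph1 mulr1 pic.
  - by rewrite rmorphD rmorphM /= pit mul0r addr0 rmorph1.
move: (congr1 (horner_eval 0) ident).
rewrite !(rmorphD, rmorphM, rmorphN, rmorphXn, rmorph_nat) /= pit pia !pic piga piL !pig.
rewrite mul0r addr0 => /(mulfI (_ : 3%:R != 0 :> {poly K}))-/(_ _)/Wrap[].
  by rewrite -(rmorph_nat (@polyC K)) polyC_eq0.
by move=> E; rewrite -!mul_polyC /lam !(rmorphM, rmorphB, rmorph_nat, rmorphXn) /= -E.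
Qed.

(** The curve [(x, x^(d+1), 1)] meets the singular point at [x = s], where these two forms vanish
    because the cube roots of unity sum to zero. *)
Lemma eigen_coord_root i : i != i0 ->
  'X - s%:P %| mmap (@polyC K) (triple 'X ('X ^+ d.+1) 1) (tnth (eigen_coord d s zeta) i).
Proof.
have s0 : s != 0 := s_neq0 s_root.
have q0 : s ^+ d.+1 != 0 by rewrite expf_neq0.
rewrite dvdp_XsubCl /root -[_.[s]]/(horner_eval s _).
rewrite (rmorph_mmap (c' := idfun)) => [|k]; last by rewrite /= /horner_eval hornerC.
rewrite -[mmap _ _ _]/(meval _ _); move: i; apply: ord3P => // _.
- rewrite (tnth_nth 0) /= !(mevalM, mevalD, mevalC, mevalXU, rmorphXn) /=.
  rewrite /horner_eval /triple !(tnth_nth 0) /= hornerX -polyC1 hornerC.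
  rewrite !mulVf // !mulr1 [X in _ * X](_ : _ = zeta ^+ 2 + zeta + 1); last by ring.
  by rewrite zeta_root mulr0.
- rewrite (tnth_nth 0) /= !(mevalM, mevalD, mevalC, mevalXU, rmorphXn) /=.
  rewrite /horner_eval /triple !(tnth_nth 0) /= hornerX -polyC1 hornerC.
  rewrite !mulVf // !mulr1 [X in _ * X](_ : _ = zeta ^+ 2 + zeta + 1); last by ring.
  by rewrite zeta_root mulr0.
Qed.

(** The operator in [blowup_equation] is diagonal on powers of the inner variable, so the leading
    coefficient already yields the eigenvalue; [b] and [c] are the exponents of a corresponding
    monomial in eigencoordinates. *)
Theorem local_cofactor : exists b c, [/\ (b + c <= e)%N,
    s * L.@[triple s (s ^+ d.+1) 1]
      = e%:R - (b + c)%:R + d%:R * (b%:R * zeta + c%:R * zeta ^+ 2) &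
    ('X - s%:P) ^+ (b + c) %| mmap (@polyC K) (triple 'X ('X ^+ d.+1) 1) F].
Proof.
have [m [g [fE g0 eqn]]] := blowup_equation.
have Ge : G \is e.-homog by apply: eigen_chart_homog.
pose j := (size g`_0).-1.
have gj : g`_0`_j != 0 by rewrite -lead_coefE lead_coef_eq0.
have [u [uG um uj]] : exists u, [/\ u \in msupp G, (u i1 + u i2 = m)%N & u i1 = j].
  apply: contrapT => nou; move/eqP: gj; apply.
  have -> : g`_0 = f`_m by rewrite fE coefXnM ltnn subnn.
  rewrite coef_blowup big_seq big1 // => u uG.
  case: eqP => [um|_]; last by rewrite mulr0.
  case: eqP => [uj|_]; last by rewrite mulr0.
  by case: nou; exists u.
have ue : mdeg u = e by move/dhomogP: Ge => /(_ _ uG).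
exists (u i1), (u i2); split.
- by rewrite -ue mdegE big_ord3 /= -addnA leq_addl.
- have := congr1 (fun p : {poly K} => p`_j) eqn.
  rewrite coefD !coefZ coefD !coefZ coefB !coefZ coefXM coef_deriv.
  have -> : (if j == 0 then 0 else g`_0`_j.-1.+1 *+ j.-1.+1) = j%:R * g`_0`_j.
    by case: (j) => [|k] /=; rewrite ?mul0r // mulr_natl.
  move=> E; apply: (mulIf gj); rewrite -E um uj -um uj natrD.
  by ring.
(* Every monomial has order at least [m] in the two coordinates vanishing at the point, which
   restrict to multiples of ['X - s%:P] on the curve. *)
have mG v : v \in msupp G -> (m <= v i1 + v i2)%N.
  move=> vG; rewrite leqNgt; apply/negP => vm.
  have := coef_blowup_homog Ge vG; rewrite -/f fE coefXnM vm coef0 => /esym/eqP.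
  by rewrite mcoeff_eq0 vG.
rewrite um -(eigen_chartK s_root zeta_root three_neq0 F) -/G mmap_comp /mmap big_seq.
apply: (big_ind (fun p => _ %| p)) => [|p r|v vG]; first exact: dvdp0.
  by move=> hp hr; rewrite dvdp_add.
apply: dvdp_mull; rewrite /mmap1 big_ord3 /= -mulrA; apply: dvdp_mull.
apply: dvdp_trans (dvdp_exp2l _ (mG _ vG)) _.
by rewrite exprD; apply: dvdp_mul; apply: dvdp_exp2r; apply: eigen_coord_root.
Qed.
End LocalCofactor.

(** * Restriction to the rational curve through the singular points *)

Section RestrictionToCurve.
Variables (K : fieldType) (d : nat).
Hypothesis char0 : forall n, n.+1%:R != 0 :> K.

Definition curve_restriction (F : {mpoly K[3]}) : {poly K} :=
  mmap (@polyC K) (triple 'X ('X ^+ d.+1) 1) F.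

Lemma coef_affine (F : {mpoly K[3]}) i j :
  (mmap (cst2 K) (triple ('X%:P) 'X 1) F)`_j`_i =
  \sum_(u <- msupp F) F@_u * ((u i1 == j) && (u i0 == i))%:R.
Proof.
rewrite /mmap coef_sum coef_sum; apply: eq_bigr => u _.
rewrite /mmap1 big_ord3 /triple !(tnth_nth 0) /= expr1n mulr1.
rewrite -rmorphXn mulrA -rmorphM coefCM coefXn -mulrA coefCM; congr (_ * _).
rewrite [j == _]eq_sym; case: eqP => _ /=; last by rewrite mulr0 coef0.
by rewrite mulr1 coefXn eq_sym.
Qed.

Lemma affine_neq0 e (F : {mpoly K[3]}) : F \is e.-homog -> F != 0 ->
  mmap (cst2 K) (triple ('X%:P) 'X 1) F != 0.
Proof.
move=> /dhomogP Fe F0; have uF := mlead_supp F0; set u := mlead F in uF.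
apply: contraTneq uF => f0; rewrite -mcoeff_eq0.
have := coef_affine F (u i0) (u i1); rewrite f0 !coef0 => /esym/eqP.
have [uF|] := boolP (u \in msupp F); last by rewrite -mcoeff_eq0.
rewrite (bigD1_seq u) ?msupp_uniq //= !eqxx mulr1 big_seq_cond big1 ?addr0 //.
move=> v /andP[vF vu]; case: eqP => [e1|_]; last by rewrite mulr0.
case: eqP => [e0|_]; last by rewrite mulr0.
have Fu : mdeg u = e := Fe _ uF; have Fv : mdeg v = e := Fe _ vF.
case/eqP: vu; apply/mnmP; move: Fu Fv; rewrite !mdegE !big_ord3 /= => Fu Fv.
by apply: ord3P; lia.
Qed.

Lemma size_curve_restriction e (F : {mpoly K[3]}) : F \is e.-homog ->
  (size (curve_restriction F) <= (d.+1 * e).+1)%N.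
Proof.
move=> /dhomogP Fe; rewrite /curve_restriction /mmap big_seq.
apply: (big_ind (fun p : {poly K} => size p <= (d.+1 * e).+1)%N).
- by rewrite size_poly0.
- by move=> p q hp hq; rewrite (leq_trans (size_polyD _ _)) // geq_max hp hq.
move=> u uF; rewrite mul_polyC (leq_trans (size_scale_leq _ _)) //.
rewrite /mmap1 big_ord3 /triple !(tnth_nth 0) /= expr1n mulr1 -exprM -exprD.
rewrite size_polyXn ltnS; have ue : mdeg u = e := Fe _ uF.
by rewrite -ue mdegE big_ord3 /=; nia.
Qed.

Lemma inner_deriv_exp (p : {poly {poly K}}) n :
  inner_deriv (p ^+ n.+1) = n.+1%:R * p ^+ n * inner_deriv p.
Proof.
elim: n => [|n IHn]; first by rewrite expr1 expr0 !mul1r.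
by rewrite exprS inner_derivM IHn exprS -[in RHS]natr1; ring.
Qed.

(** Setting [y = Q] kills [P], so only the terms survive in which a derivative has fallen on a
    factor [P]. *)
Lemma evaluate_on_curve k e (Q Q' : {poly K}) (P x y q' g ga gt l : {poly {poly K}}) :
  horner_eval Q P = 0 -> horner_eval Q x = 'X -> horner_eval Q y = Q ->
  horner_eval Q q' = Q' ->
  (1 - x * y ^+ d) * (P * ga - k.+1%:R * q' * g)
    + (x ^+ d - y ^+ d.+1) * (k.+1%:R * g + P * gt) = (l - e%:R * y ^+ d) * (P * g) ->
  (1 - 'X * Q ^+ d) * - (k.+1%:R * Q' * horner_eval Q g)
    + ('X ^+ d - Q ^+ d.+1) * (k.+1%:R * horner_eval Q g) = 0.
Proof.
move=> vP vx vy vQ /(congr1 (horner_eval Q)).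
rewrite !(rmorphD, rmorphM, rmorphN, rmorphXn, rmorph_nat, rmorph1) /= vP vx vy vQ.
by rewrite !mul0r !mulr0 add0r addr0.
Qed.

(* The curve [y z^d = x^(d+1)] is not invariant, so the order of vanishing of [F]
   along it is zero. *)
Lemma curve_restriction_neq0 e (F L : {mpoly K[3]}) : (0 < d)%N ->
  F \is e.-homog -> F != 0 -> jouanolou_darboux d F L -> curve_restriction F != 0.
Proof.
move=> d0 Fe F0 FL.
pose x : {poly {poly K}} := 'X%:P; pose y : {poly {poly K}} := 'X.
pose h := triple x y 1; pose f := mmap (cst2 K) h F.
have f0 : f != 0 := affine_neq0 Fe F0.
pose Q : {poly K} := 'X ^+ d.+1.
have cE : curve_restriction F = f.[Q].
  rewrite -[f.[Q]]/(horner_eval Q f) (rmorph_mmap (c' := @polyC K)) => [|k]; last first.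
    by rewrite /= /horner_eval hornerC.
  apply: eq_mmap; apply: ord3P; rewrite /triple !(tnth_nth 0) /= /horner_eval.
  - by rewrite hornerC.
  - by rewrite hornerX.
  - by rewrite -polyC1 hornerC.
have [k [g /implyP/(_ f0) gQ fE]] := multiplicity_XsubC f Q.
rewrite cE; case: k fE => [|k] fE; first by rewrite fE expr0 mulr1.
exfalso; set P := y - Q%:P in fE.
pose A i := mmap (cst2 K) h F^`M(i); pose Lf := mmap (cst2 K) h L.
have fy : f^`() = A i1.
  rewrite /f (mmap_derivation h F (@derivD _) (@derivM _) (@cst2_deriv K)) big_ord3 /=.
  rewrite -/(A i0) -/(A i1) -/(A i2) /h /triple !(tnth_nth 0) /=.
  by rewrite /x /y -polyC1 derivX !derivC; ring.
have fx : inner_deriv f = A i0.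
  rewrite /f (mmap_derivation h F (@inner_derivD _) (@inner_derivM _) (@cst2_inner_deriv K)).
  rewrite big_ord3 /= -/(A i0) -/(A i1) -/(A i2) /h /triple !(tnth_nth 0) /=.
  have -> : inner_deriv 1 = 0 :> {poly {poly K}} by rewrite -polyC1 inner_derivC derivC.
  by rewrite /x /y inner_derivX inner_derivC derivX polyC1; ring.
have eul : x * A i0 + y * A i1 + A i2 = e%:R * f.
  have := congr1 (mmap (cst2 K) h) (euler_identity Fe).
  rewrite big_ord3 /= !(rmorphD, rmorphM, rmorphMn) /= -/f mulr_natl => <-.
  by rewrite !mmapX !mmap1U /h /triple !(tnth_nth 0) /= mul1r.
have dar : A i0 + x ^+ d * A i1 + y ^+ d * A i2 = Lf * f.
  have := congr1 (mmap (cst2 K) h) FL.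
  rewrite !(rmorphD, rmorphM, rmorphXn) /= !mmapX !mmap1U.
  by rewrite /h /triple !(tnth_nth 0) /= expr1n mul1r.
(* Euler's identity removes the derivative in [z] and leaves the affine field with components
   [1 - x y^d] and [x^d - y^(d+1)]. *)
have eqf : (1 - x * y ^+ d) * inner_deriv f + (x ^+ d - y ^+ d.+1) * f^`()
    = (Lf - e%:R * y ^+ d) * f.
  transitivity (Lf * f - y ^+ d * (e%:R * f)); last by ring.
  by rewrite -dar -eul fx fy exprS; ring.
have Py : f^`() = P ^+ k * (k.+1%:R * g + P * g^`()).
  rewrite fE derivM deriv_exp derivB derivX derivC subr0 mul1r /= -mulr_natr exprS; ring.
have Px : inner_deriv f = P ^+ k * (P * inner_deriv g - k.+1%:R * (Q^`())%:P * g).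
  have -> : inner_deriv f = inner_deriv g * P ^+ k.+1 + g * (k.+1%:R * P ^+ k * - (Q^`())%:P).
    rewrite fE inner_derivM inner_deriv_exp /P -polyCN inner_derivD inner_derivC.
    by rewrite /y inner_derivX add0r derivN ?polyCN.
  by rewrite exprS; ring.
have P0 : P != 0 by rewrite polyXsubC_eq0.
have {eqf} eqg : (1 - x * y ^+ d) * (P * inner_deriv g - k.+1%:R * (Q^`())%:P * g)
    + (x ^+ d - y ^+ d.+1) * (k.+1%:R * g + P * g^`())
    = (Lf - e%:R * y ^+ d) * (P * g).
  apply: (mulfI (expf_neq0 k P0)).
  transitivity ((Lf - e%:R * y ^+ d) * f); last by rewrite fE exprS; ring.
  by rewrite -eqf Px Py; ring.
have vP : horner_eval Q P = 0 by rewrite /horner_eval hornerXsubC subrr.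
have vx : horner_eval Q x = 'X by rewrite /horner_eval hornerC.
have vy : horner_eval Q y = Q by rewrite /horner_eval hornerX.
have vQ : horner_eval Q (Q^`())%:P = Q^`() by rewrite /horner_eval hornerC.
have {eqg} E := evaluate_on_curve vP vx vy vQ eqg.
(* On the curve, the field applied to [P] is [d x^d (x^N - 1)] with [N = d^2 + d + 1], a nonzero
   polynomial; this is the failure of invariance. *)
have {E} : k.+1%:R * (horner_eval Q g * (d%:R * ('X ^+ d * ('X ^+ (d ^ 2 + d + 1) - 1)))) = 0 :> {poly K}.
  rewrite -E /Q derivXn -mulr_natr -!exprM.
  have -> : 'X ^+ (d ^ 2 + d + 1) = 'X * 'X ^+ (d.+1 * d) :> {poly K}.
    by rewrite -exprS; congr (_ ^+ _); lia.
  have -> : 'X ^+ (d.+1 * d.+1) = 'X ^+ d * ('X * 'X ^+ (d.+1 * d)) :> {poly K}.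
    by rewrite -exprS -exprD; congr (_ ^+ _); lia.
  by rewrite -natr1 /=; ring.
apply/eqP; rewrite !mulf_neq0 //.
- by rewrite -(rmorph_nat (@polyC K)) polyC_eq0 char0.
- by case: (d) d0 => // d' _; rewrite -(rmorph_nat (@polyC K)) polyC_eq0 char0.
- by rewrite expf_neq0 // polyX_eq0.
- by rewrite -size_poly_eq0 size_XnsubC // addn1.
Qed.
End RestrictionToCurve.

(** * Roots of unity and counting of multiplicities *)

Lemma closed_prim_root_exists (K : closedFieldType) n :
  (0 < n)%N -> n%:R != 0 :> K -> exists z : K, n.-primitive_root z.
Proof.
move=> n0 nK; have [r Dp] := closed_field_poly_normal ('X^n - 1 : {poly K}).
rewrite (monicP _) ?monicXnsubC // scale1r in Dp.
have rn1 : all n.-unity_root r by apply/allP => z; rewrite -root_prod_XsubC -Dp.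
have sz_r : (n < (size r).+1)%N.
  by rewrite -(size_prod_XsubC r id) -Dp size_XnsubC.
have [|z _ zn] := hasP (has_prim_root n0 rn1 _ sz_r); last by exists z.
by rewrite -separable_prod_XsubC -Dp separable_Xn_sub_1.
Qed.

Lemma sum_expr_unity_root (K : fieldType) n (w : K) :
  w ^+ n = 1 -> w != 1 -> \sum_(k < n) w ^+ k = 0.
Proof.
move=> wn w1; have := subrX1 w n; rewrite wn subrr => /esym/eqP.
by rewrite mulf_eq0 subr_eq0 (negPf w1) => /eqP.
Qed.

Lemma sum_root_multiplicities (K : fieldType) n (r : nat -> K) (m : nat -> nat)
    (c : {poly K}) :
  {in gtn n &, injective r} -> c != 0 ->
  (forall k, (k < n)%N -> ('X - (r k)%:P) ^+ m k %| c) ->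
  (\sum_(k < n) m k < size c)%N.
Proof.
move=> rI c0 mc; pose p n := \prod_(k < n) ('X - (r k)%:P) ^+ m k.
have sp l : size (p l) = (\sum_(k < l) m k).+1.
  elim: l => [|l IHl]; first by rewrite /p !big_ord0 size_poly1.
  rewrite /p !big_ord_recr /= -/(p l) size_monicM ?monic_exp ?monicXsubC //.
  - by rewrite IHl size_exp_XsubC addnS.
  - by apply: monic_prod => i _; rewrite monic_exp ?monicXsubC.
  - by rewrite expf_neq0 // polyXsubC_eq0.
have pc l : (l <= n)%N -> p l %| c.
  elim: l => [|l IHl] ln; first by rewrite /p big_ord0 dvd1p.
  rewrite /p big_ord_recr /= -/(p l) Gauss_dvdp; first by rewrite IHl ?mc // ltnW.
  apply: coprimep_expr; rewrite coprimep_XsubC /root horner_prod.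
  apply/prodf_neq0 => k _; rewrite horner_exp hornerXsubC expf_neq0 // subr_eq0.
  have kl := ltn_ord k; apply/eqP => /rI lk; have := kl; rewrite -lk ?ltnn //.
  by rewrite inE; apply: ltn_trans ln.
by rewrite -sp dvdp_leq // pc.
Qed.

(** The norm of [a + b zeta] is the integer [a^2 - a b + b^2], a positive definite form. *)
Lemma zeta_independent (K : numFieldType) (zeta : K) (a b : int) :
  zeta ^+ 2 + zeta + 1 = 0 -> a%:~R + b%:~R * zeta = 0 -> a = 0 /\ b = 0.
Proof.
move=> hz hab.
have : (a ^+ 2 - a * b + b ^+ 2)%:~R = 0 :> K.
  rewrite !(rmorphD, rmorphN, rmorphM, rmorphXn) /=.
  have -> : a%:~R = - (b%:~R * zeta) by apply/eqP; rewrite -addr_eq0 hab.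
  by rewrite -[RHS](mulr0 (b%:~R ^+ 2)) -hz; ring.
move=> /eqP; rewrite intr_eq0 => /eqP ab.
have b0 : b = 0 by nia.
by split=> //; move: ab; rewrite b0; nia.
Qed.

(** * Nonexistence of Darboux polynomials *)

Section NoDarboux.
Variables (K : numClosedFieldType) (d : nat).
Hypothesis d_ge2 : (2 <= d)%N.

(** A monomial [u] of [L] contributes the power of [eta ^+ k] with exponent [1 + u0 + (d + 1) u1].
    This lies between 1 and [d^2], so it is no multiple of the order [d^2 + d + 1] and its geometric
    sum vanishes. *)
Lemma sum_cofactor (L : {mpoly K[3]}) eta : L \is d.-1.-homog ->
  (d ^ 2 + d + 1).-primitive_root eta ->
  \sum_(k < (d ^ 2 + d + 1)%N)
     eta ^+ k * L.@[triple (eta ^+ k) ((eta ^+ k) ^+ d.+1) 1] = 0.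
Proof.
move=> /dhomogP Ld eta_prim; under eq_bigr do rewrite mevalE mulr_sumr.
rewrite exchange_big big_seq big1 //= => u uL.
transitivity (L@_u * \sum_(k < d ^ 2 + d + 1) (eta ^+ (1 + u i0 + d.+1 * u i1)) ^+ k).
  rewrite mulr_sumr; apply: eq_bigr => k _; rewrite mulrCA; congr (_ * _).
  rewrite big_ord3 /triple !(tnth_nth 0) /= expr1n mulr1 -!exprM -!exprD.
  by congr (_ ^+ _); nia.
rewrite sum_expr_unity_root ?mulr0 //.
  by rewrite -exprM mulnC exprM (prim_expr_order eta_prim) expr1n.
rewrite -(prim_order_dvd eta_prim); apply/negP => /dvdn_leq -/(_ isT).
have : mdeg u = d.-1 := Ld _ uL.
by rewrite mdegE big_ord3 /=; nia.
Qed.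

Theorem jouanolou_no_darboux e (F L : {mpoly K[3]}) : (0 < e)%N ->
  F != 0 -> F \is e.-homog -> L \is d.-1.-homog -> ~ jouanolou_darboux d F L.
Proof.
move=> e0 F0 Fe Ld FL; set N := (d ^ 2 + d + 1)%N.
have [||eta eta_prim] := @closed_prim_root_exists K N; first by rewrite /N addn1.
  by rewrite pnatr_eq0 /N addn1.
have [|xi xi_prim] := @closed_prim_root_exists K 3 isT; first by rewrite pnatr_eq0.
have xi0 : xi ^+ 2 + xi + 1 = 0.
  have := @sum_expr_unity_root K 3 xi (prim_expr_order xi_prim).
  rewrite !big_ord_recl big_ord0 expr0 expr1 addr0 => <-; first by ring.
  by rewrite -[xi]expr1 -(prim_order_dvd xi_prim).
have etaN k : (eta ^+ k) ^+ N = 1 by rewrite -exprM mulnC exprM (prim_expr_order eta_prim) expr1n.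
have n3 : 3%:R != 0 :> K by rewrite pnatr_eq0.
have /choice[bc bcP] k := @local_cofactor K d _ xi (etaN k) xi0 n3 e F L F0 Fe FL.
have /choice[cc ccP] := bcP.
set C := curve_restriction d F.
have C0 : C != 0.
  by apply: (curve_restriction_neq0 _ _ Fe F0 FL) => [n|]; rewrite ?pnatr_eq0 // ltnW.
have size_bound : (\sum_(k < N) (bc k + cc k) < size C)%N.
  apply: (sum_root_multiplicities (r := fun k => eta ^+ k) (m := fun k => (bc k + cc k)%N)) => //.
    move=> k l /= kN lN /eqP; rewrite (eq_prim_root_expr eta_prim) !modn_small //.
    by move/eqP.
  by move=> k _; have [_ _] := ccP k.
have := sum_cofactor Ld eta_prim; rewrite -/N => sum0.
pose b := (\sum_(k < N) bc k)%N; pose c := (\sum_(k < N) cc k)%N.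
have bc_le : (b + c <= N * e)%N.
  rewrite /b /c -big_split /=; apply: leq_trans (_ : \sum_(k < N) e <= _)%N.
    by apply: leq_sum => k _; have [] := ccP k.
  by rewrite sum_nat_const card_ord.
have eqn : (N * e)%:R - (b + c)%:R + d%:R * (b%:R * xi + c%:R * xi ^+ 2) = 0 :> K.
  rewrite -[RHS]sum0.
  under [RHS]eq_bigr => k _ do have [_ -> _] := ccP k.
  rewrite big_split sumrB sumr_const card_ord -mulr_sumr big_split /= -!mulr_suml.
  by rewrite natrM mulr_natl -natr_sum big_split /= -!natr_sum.
(* Replacing [xi^2] by [- xi - 1] splits the relation into two integer equations; the coefficient of
   [xi] gives [b = c]. *)
have [|h1 h2] := @zeta_independent K xi ((N * e)%:Z - (b + c)%:Z - (d * c)%:Z) ((d * b)%:Z - (d * c)%:Z) xi0.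
  rewrite !rmorphB /= -eqn.
  have -> : xi ^+ 2 = - xi - 1 by apply/eqP; rewrite -subr_eq0 -xi0; apply/eqP; ring.
  by rewrite !natrD !natrM; ring.
have := size_curve_restriction d Fe; rewrite -/C => sizeC.
move: size_bound; rewrite big_split /= -/b -/c => size_bound.
have bcE : b = c by nia.
have {size_bound sizeC} : (b + c <= d.+1 * e)%N by have := leq_trans size_bound sizeC; rewrite ltnS.
rewrite -bcE in h1 *; rewrite addnn -muln2 => h3.
have {h1} h1 : (N * e = (d + 2) * b)%N by lia.
(* With [N e = (d + 2) b] this becomes [2 (d^2 + d + 1) <= (d + 1) (d + 2)], that is [d^2 <= d],
   which fails for [d >= 2]. *)
have : ((d + 2) * (b * 2) <= (d + 2) * (d.+1 * e))%N by rewrite leq_mul2l h3 orbT.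
rewrite mulnA -h1 /N !mulnA -(mulnA _ e 2) (mulnC e 2) mulnA leq_pmul2r //.
by nia.
Qed.
End NoDarboux.

(** * The foliation of Jouanolou *)

Lemma vlineZ (K : fieldType) (V : vectType K) (c : K) (v : V) :
  c != 0 -> <[c *: v]>%VS = <[v]>%VS.
Proof.
move=> c0; apply/eqP; rewrite eqEsubv -!memvE memvZ ?memv_line //=.
by rewrite -[X in X \in _](scalerK c0) memvZ ?memv_line.
Qed.

Lemma coef_mulX0 (K : nzRingType) n (b : {mpoly K[n]}) j (m : 'X_{1..n}) :
  m j = 0%N -> (b * 'X_j)@_m = 0.
Proof.
move=> mj; rewrite [b]mpolyE mulr_suml raddf_sum big1 //= => u _.
rewrite -scalerAl -mpolyXD mcoeffZ mcoeffX.
case: eqP => [e|_]; last by rewrite mulr0.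
by move: mj; rewrite -e mnmDE mnm1E eqxx addn1.
Qed.

(** The variable ['X_j] divides [a * 'X_i] but not ['X_i]; divisibility of [a] is checked on each
    monomial. *)
Lemma divide_by_variable (K : idomainType) n k (a b : {mpoly K[n]}) i j :
  i != j -> a * 'X_i = b * 'X_j -> a \is k.+1.-homog ->
  exists2 L, L \is k.-homog & a = L * 'X_j.
Proof.
move=> ij ab ak.
have mj m : m \in msupp a -> (U_(j) <= m)%MM.
  move=> ma; rewrite lep1mP; apply: contraTN ma => /eqP mj0.
  rewrite -mcoeff_eq0 -(mcoeffMX a U_(i)%MM m) ab coef_mulX0 //.
  by rewrite mnmDE mnm1E (negPf ij) mj0.
exists (\sum_(m <- msupp a) a@_m *: 'X_[m - U_(j)]).
  rewrite big_seq; apply: rpred_sum => m ma; apply: rpredZ.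
  rewrite dhomogX; apply/eqP; have am : mdeg m = k.+1 := dhomog_mf ak ma.
  by apply: succn_inj; rewrite -am -[in RHS](submK (mj _ ma)) mdegD mdeg1 addn1.
rewrite mulr_suml {1}[a]mpolyE; apply: eq_big_seq => m ma.
by rewrite -scalerAl -mpolyXD submK // mj.
Qed.

Lemma mderiv_homog (K : nzRingType) n e (p : {mpoly K[n]}) i :
  p \is e.+1.-homog -> p^`M(i) \is e.-homog.
Proof.
move=> pe; apply/dhomogP => m; rewrite mcoeff_msupp mcoeff_deriv => pm.
apply/eqP; apply: contraNT pm => me; rewrite (dhomog_nemf_coeff pe) ?mul0rn //.
by change (mdeg (m + U_(i))%MM != e.+1); rewrite mdegD mdeg1 addn1 eqSS.
Qed.

Section JouanolouForm.
Variables (K : numClosedFieldType) (d : nat).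

(** The cross product of [(x, y, z)] with the vector field [(z^d, x^d, y^d)], hence annihilated by
    the radial field. *)
Definition jouanolou_coef : 'I_3 -> {mpoly K[3]} :=
  triple ('X_i1 ^+ d.+1 - 'X_i2 * 'X_i0 ^+ d)
         ('X_i2 ^+ d.+1 - 'X_i0 * 'X_i1 ^+ d)
         ('X_i0 ^+ d.+1 - 'X_i1 * 'X_i2 ^+ d).

Lemma mpolyX_exp_homog i k : ('X_i : {mpoly K[3]}) ^+ k \is k.-homog.
Proof. by rewrite -[k in k.-homog]mul1n dhomogMn // dhomogX; apply/eqP/mdeg1. Qed.

Lemma jouanolou_coef_homog i : jouanolou_coef i \is d.+1.-homog.
Proof.
have hX i' k : ('X_i' : {mpoly K[3]}) * 'X_k ^+ d \is d.+1.-homog.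
  exact: (@dhomogM _ _ _ 1 _ d) (mpolyX_exp_homog i' 1) (mpolyX_exp_homog k d).
by move: i; apply: ord3P; rewrite /jouanolou_coef /triple (tnth_nth 0) /=;
  apply: rpredB (mpolyX_exp_homog _ _) (hX _ _).
Qed.

Definition jouanolou_oneform : homog_oneform K d.+1 :=
  [ffun i => DHomog (jouanolou_coef_homog i)].

Lemma jouanolou_twisted : jouanolou_oneform \in twisted_oneforms K d.
Proof.
rewrite mem_twisted_oneforms big_ord3 /jouanolou_oneform !ffunE /=.
by rewrite /jouanolou_coef /triple !(tnth_nth 0) /= !exprS; apply/eqP; ring.
Qed.

Definition jouanolou : H0 K d := Subvs jouanolou_twisted.

Lemma component_jouanolou i : component jouanolou i = jouanolou_coef i.
Proof. by rewrite /component /= ffunE. Qed.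

Lemma jouanolou_singular_finite : finite_set (singular_locus jouanolou).
Proof.
pose N := (d ^ 2 + d + 1)%N.
have [rs Prs] := closed_field_poly_normal ('X^N - 1 : {poly K}).
pose P s : 'rV[K]_3 := \row_j triple s (s ^+ d.+1) 1 j.
apply: (@sub_finite_set _ _ (image [set` rs]%classic (fun s => <[P s]>%VS))); last first.
  exact/finite_image/finite_seq.
move=> _ [p /= [p0 psing] <-].
have ev i : (jouanolou_coef i).@[p 0] = 0 by rewrite -component_jouanolou psing.
have eA : p 0 i1 ^+ d.+1 - p 0 i2 * p 0 i0 ^+ d = 0.
  by have := ev i0; rewrite /jouanolou_coef /triple (tnth_nth 0) /= mevalB mevalM !rmorphXn /= !mevalXU.
have eB : p 0 i2 ^+ d.+1 - p 0 i0 * p 0 i1 ^+ d = 0.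
  by have := ev i1; rewrite /jouanolou_coef /triple (tnth_nth 0) /= mevalB mevalM !rmorphXn /= !mevalXU.
have eC : p 0 i0 ^+ d.+1 - p 0 i1 * p 0 i2 ^+ d = 0.
  by have := ev i2; rewrite /jouanolou_coef /triple (tnth_nth 0) /= mevalB mevalM !rmorphXn /= !mevalXU.
(* On the line [z = 0] the first equation gives [y = 0] and then the third gives [x = 0]. *)
have z0 : p 0 i2 != 0.
  apply: contraNneq p0 => z0; move/eqP: eA; rewrite z0 mul0r subr0 expf_eq0 /= => /eqP y0.
  move/eqP: eC; rewrite y0 mul0r subr0 expf_eq0 /= => /eqP x0.
  by apply/eqP/rowP; apply: ord3P; rewrite mxE.
have [s xE] : exists s, p 0 i0 = p 0 i2 * s.
  by exists (p 0 i0 / p 0 i2); rewrite mulrCA mulfV // mulr1.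
have yE : p 0 i1 = p 0 i2 * s ^+ d.+1.
  apply: (mulIf (expf_neq0 d z0)); move/subr0_eq: eC => <-.
  by rewrite xE exprMn exprS; ring.
have sN : s ^+ N = 1.
  apply: (mulfI (expf_neq0 d.+1 z0)); rewrite mulr1; move/subr0_eq: eB => {2}->.
  rewrite xE yE exprMn -exprM /N (_ : (d ^ 2 + d + 1 = (d.+1 * d).+1)%N); last by lia.
  by rewrite !exprS; ring.
exists s => /=.
  have Pm : 'X^N - 1 \is @monic K by rewrite monicXnsubC // /N addn1.
  rewrite (monicP Pm) scale1r in Prs.
  by rewrite -root_prod_XsubC -Prs /root !hornerE sN subrr.
rewrite -(vlineZ (P s) z0); congr (<[_]>%VS).
by apply/rowP; apply: ord3P; rewrite !mxE /triple (tnth_nth 0) /= ?mulr1 -?xE -?yE.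
Qed.

Lemma jouanolou_neq0 : jouanolou != 0.
Proof.
apply/eqP => /(congr1 (fun w => (component w i2).@[triple 1 0 0])).
rewrite component_jouanolou /jouanolou_coef [X in X.@[_]]/triple [X in X.@[_]](tnth_nth 0) /=.
rewrite mevalB mevalM !rmorphXn /= !mevalXU /triple !(tnth_nth 0) /=.
rewrite expr1n mul0r subr0.
have -> : component (0 : H0 K d) i2 = 0 by rewrite /component linear0 ffunE.
rewrite meval0 => /eqP.
by rewrite oner_eq0.
Qed.

Lemma jouanolou_foliation : defines_foliation jouanolou.
Proof. by split; [exact: jouanolou_neq0|exact: jouanolou_singular_finite]. Qed.

(** Two entries of the wedge, combined with Euler's identity, show that [F] divides both [z DF] and
    [x DF], where [DF] is the vector field applied to [F]. Comparing the quotients makes the first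
    divisible by [z], which gives a cofactor of degree [d.-1]. *)
Lemma jouanolou_no_invariant e (F : {mpoly K[3]}) (T : 'M[{mpoly K[3]}]_3) :
  (2 <= d)%N -> (0 < e)%N -> F != 0 -> F \is e.-homog ->
  (forall i j, T i j \is d.-homog) ->
  wedge (differential F) (component jouanolou) = F *: T -> False.
Proof.
move=> d2 e0 F0 Fe Td; rewrite (funext component_jouanolou) => /matrixP FT.
pose DF := 'X_i2 ^+ d * F^`M(i0) + 'X_i0 ^+ d * F^`M(i1) + 'X_i1 ^+ d * F^`M(i2).
have eul : 'X_i0 * F^`M(i0) + 'X_i1 * F^`M(i1) + 'X_i2 * F^`M(i2) = e%:R * F.
  by have := euler_identity Fe; rewrite big_ord3 /= mulr_natl.
pose a := T i0 i1 + e%:R * 'X_i1 ^+ d; pose b := T i1 i2 + e%:R * 'X_i2 ^+ d.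
have Ea : 'X_i2 * DF = F * a.
  have := FT i0 i1; rewrite !mxE /differential /jouanolou_coef /triple !(tnth_nth 0) /=.
  move=> FTe; rewrite /a [RHS]mulrDr -FTe; rewrite [F * _](_ : _ = 'X_i1 ^+ d * (e%:R * F)); last by ring.
  by rewrite -eul /DF !exprS; ring.
have Eb : 'X_i0 * DF = F * b.
  have := FT i1 i2; rewrite !mxE /differential /jouanolou_coef /triple !(tnth_nth 0) /=.
  move=> FTe; rewrite /b [RHS]mulrDr -FTe; rewrite [F * (_ * _)](_ : _ = 'X_i2 ^+ d * (e%:R * F)); last by ring.
  by rewrite -eul /DF !exprS; ring.
have ab : a * 'X_i0 = b * 'X_i2.
  apply: (mulfI F0); rewrite !mulrA -Ea -Eb; ring.
have ad : a \is d.-1.+1.-homog.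
  rewrite prednK ?rpredD ?(ltnW d2) //.
  by rewrite mulr_natl rpredMn // mpolyX_exp_homog.
have [L Ld aL] := divide_by_variable (isT : i0 != i2) ab ad.
apply: (jouanolou_no_darboux d2 e0 F0 Fe Ld).
have X0 : 'X_i2 != 0 :> {mpoly K[3]} by rewrite -msize_poly_eq0 msizeX.
by apply: (mulfI X0); rewrite -/DF Ea aL; ring.
Qed.
End JouanolouForm.

(** * Invariant curves of a given degree *)

Section InvariantCurvesOfGivenDegree.
Variables (K : numClosedFieldType) (d e : nat).

(** The form of invariance to which elimination applies: [F] and [T] range over fixed
    finite-dimensional spaces. *)
Definition has_invariant (w : H0 K d) := exists (F : {mpoly K[3]}) (T : 'M[{mpoly K[3]}]_3),
  [/\ F != 0, F \is e.-homog, forall i j, T i j \is d.-homog &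
      wedge (differential F) (component w) = F *: T].

Lemma component_linear a (u v : H0 K d) i :
  component (a *: u + v) i = a *: component u i + component v i.
Proof. by rewrite /component linearP !ffunE. Qed.

Lemma has_invariantZ c w : c != 0 -> has_invariant w -> has_invariant (c *: w).
Proof.
move=> c0 [F [T [F0 Fe Td FT]]]; exists F, (\matrix_(i, j) (c *: T i j)); split=> //.
  by move=> i j; rewrite mxE rpredZ.
apply/matrixP => i j; move/matrixP: FT => /(_ i j); rewrite !mxE => FT.
have cE k : component (c *: w) k = c *: component w k.
  by rewrite -[c *: w]addr0 component_linear /component linear0 ffunE addr0.
by rewrite !cE -!scalerAr -scalerBr FT scalerAr.
Qed.

(** The left side of the invariance equation has degree [e + d], so every nonzero entry of [T] has
    degree [d]; zero entries count as homogeneous of any degree. *)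
Lemma invariant_curve_has_invariant w (F : {mpoly K[3]}) :
  F \is e.-homog -> (0 < e)%N -> invariant_curve w F -> has_invariant w.
Proof.
move=> Fe e0 [[F0 _ _] [T [_ [k Tk] FT]]]; exists F, T; split=> // i j.
have [->|Tij] := eqVneq (T i j) 0; first exact: rpred0.
suff -> : d = k by [].
have we : F * T i j \is (e + d)%N.-homog.
  move/matrixP: FT => /(_ i j); rewrite !mxE /differential => <-.
  have h k' l : F^`M(k') * component w l \is (e + d)%N.-homog.
    have -> : (e + d = e.-1 + d.+1)%N by lia.
    apply: dhomogM; first by apply: mderiv_homog; rewrite prednK.
    exact: dhomog_is_dhomog.
  by rewrite rpredB.
have wk : F * T i j \is (e + k)%N.-homog by apply: dhomogM.
have FT0 : F * T i j != 0 by rewrite mulf_neq0.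
exact: addnI (dhomog_uniq FT0 we wk).
Qed.

Local Notation U := (dhomog 3 K e).
Local Notation W := {ffun 'I_3 * 'I_3 -> dhomog 3 K d}.
Local Notation fU k := (val (vbasis {:U})`_k : {mpoly K[3]}).
Local Notation fW l ij := (val ((vbasis {:W})`_l ij) : {mpoly K[3]}).
Local Notation b := (e + d).+1.
Local Notation idx := ('I_3 * 'I_3 * 'X_{1..3 < b})%type.

(* The row space of the matrices [incidence_mx] is the linear map
   F |-> y_0 dF /\ w - F Theta, where [Theta] has coordinates y_1, y_2, ... *)
Definition incidence_mx (i : 'I_(\dim {:W}).+1) (w : H0 K d) :
    'M[K]_(\dim {:U}, #|{: idx}|) :=
  \matrix_(k < \dim {:U}, c < #|{: idx}|) let: (ij, m) := enum_val c : idx in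
    if unlift ord0 i is Some l then - (fU k * fW l ij)@_m
    else (wedge (differential (fU k)) (component w) ij.1 ij.2)@_m.

Lemma incidence_mxE (y : 'I_(\dim {:W}).+1 -> K) (u : 'rV_(\dim {:U})) w c :
  let F := \sum_k u 0 k *: fU k in
  let: (ij, m) := enum_val c : idx in
  (u *m \sum_i y i *: incidence_mx i w) 0 c =
  (y ord0 *: wedge (differential F) (component w) ij.1 ij.2
   - F * \sum_l y (lift ord0 l) *: fW l ij)@_m.
Proof.
move=> F; case ce : (enum_val c : idx) => [ij m].
set Theta := \sum_l y (lift ord0 l) *: _.
have -> : wedge (differential F) (component w) ij.1 ij.2
    = \sum_k u 0 k *: wedge (differential (fU k)) (component w) ij.1 ij.2.
  rewrite mxE /differential /F !raddf_sum /= !mulr_suml -sumrB; apply: eq_bigr => k _.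
  by rewrite !mxE !mderivZ -!scalerAl scalerBr.
have -> : F * Theta = \sum_k u 0 k *: (fU k * Theta).
  by rewrite mulr_suml; apply: eq_bigr => k _; rewrite scalerAl.
have coef_sum n (f : 'I_n -> {mpoly K[3]}) : (\sum_i f i)@_m = \sum_i (f i)@_m.
  exact: raddf_sum.
rewrite [LHS]mxE [in RHS]scaler_sumr -sumrB coef_sum; apply: eq_bigr => k _.
rewrite summxE big_ord_recl !mxE ce unlift_none ?mxE.
rewrite !(mcoeffB, mcoeffZ) mulrDr mulrCA; congr (_ + _).
rewrite -mulrN; congr (_ * _); rewrite /Theta mulr_sumr coef_sum -sumrN.
apply: eq_bigr => l _; rewrite !mxE ce liftK.
by rewrite -scalerAr mcoeffZ mulrN.
Qed.

Lemma incidence_polyfun i k c : polyfun (fun w => incidence_mx i w k c).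
Proof.
case ce : (enum_val c : idx) => [ij m]; case ul : (unlift ord0 i) => [l|].
  have [P hP] := polyfun_cst (H0 K d) (- (fU k * fW l ij)@_m).
  by exists P => w; rewrite -hP mxE ce ul.
apply: polyfun_linear => a u v; rewrite !mxE ce ul !mxE !component_linear.
by rewrite !mulrDr -!scalerAr !(mcoeffB, mcoeffD, mcoeffZ); ring.
Qed.

Lemma dim_dhomog_gt0 : (0 < \dim {:U})%N.
Proof.
rewrite lt0n dimv_eq0; apply/eqP => U0.
have Xe : ('X_ord0 : {mpoly K[3]}) ^+ e \is e.-homog := mpolyX_exp_homog _ _ _.
have := memvf (DHomog Xe); rewrite U0 memv0 => /eqP/(congr1 val)/= /eqP.
by rewrite expf_eq0 -msize_poly_eq0 msizeX andbF.
Qed.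

Lemma basis_dhomog_homog (u : 'rV_(\dim {:U})) : \sum_k u 0 k *: fU k \is e.-homog.
Proof. by apply: rpred_sum => k _; rewrite rpredZ // dhomog_is_dhomog. Qed.

Lemma basis_dhomog_free (u : 'rV_(\dim {:U})) :
  \sum_k u 0 k *: fU k = 0 -> forall k, u 0 k = 0.
Proof.
move=> F0 k; have /basis_free fr := vbasisP {:U}.
rewrite -(coord_sum_free (u 0) k fr).
rewrite (_ : \sum_(i < _) _ = 0) ?linear0 //; apply/val_inj => /=.
by rewrite raddf_sum -[RHS]F0.
Qed.

Lemma basis_ffun_free (y : 'I_(\dim {:W}) -> K) :
  (forall ij, \sum_l y l *: fW l ij = 0) -> forall l, y l = 0.
Proof.
move=> F0 k; have /basis_free fr := vbasisP {:W}.
rewrite -(coord_sum_free y k fr).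
rewrite (_ : \sum_(i < _) _ = 0) ?linear0 //; apply/ffunP => ij; apply/val_inj => /=.
rewrite sum_ffunE ffunE raddf_sum /= -[RHS](F0 ij).
by apply: eq_bigr => l _; rewrite ffunE.
Qed.

(** The columns record the coefficients of degree at most [e + d]; those beyond vanish because the
    difference is homogeneous of degree [e + d]. *)
Lemma incidence_mx_ker (y : 'I_(\dim {:W}).+1 -> K) (u : 'rV_(\dim {:U})) w i j :
  (0 < e)%N -> u *m \sum_i y i *: incidence_mx i w = 0 ->
  let F := \sum_k u 0 k *: fU k in
  y ord0 *: wedge (differential F) (component w) i j
  = F * \sum_l y (lift ord0 l) *: fW l (i, j).
Proof.
move=> e0 uM F; set Th := \sum_l y (lift ord0 l) *: _; apply: subr0_eq; apply/mpolyP => m.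
rewrite mcoeff0; have [mb|mb] := ltnP (mdeg m) b.
  pose c := enum_rank ((i, j), BMultinom mb).
  have := incidence_mxE y u w c; rewrite {1}/c enum_rankK => <-.
  by rewrite uM mxE.
have Fe : F \is e.-homog := basis_dhomog_homog u.
suff hom : y ord0 *: wedge (differential F) (component w) i j - F * Th \is (e + d)%N.-homog.
  by rewrite (dhomog_nemf_coeff hom) // gtn_eqF.
have h k l : F^`M(k) * component w l \is (e + d)%N.-homog.
  have -> : (e + d = e.-1 + d.+1)%N by lia.
  apply: dhomogM; first by apply: mderiv_homog; rewrite prednK.
  exact: dhomog_is_dhomog.
apply: rpredB; first by rewrite mxE; apply: rpredZ; apply: rpredB; apply: h.
apply: dhomogM => //; apply: rpred_sum => l _.
by rewrite rpredZ // dhomog_is_dhomog.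
Qed.

(** The unknowns are [F], as the kernel vector [u], and [Theta] together with a homogenising
    coordinate [y ord0]. Elimination yields a polynomial, one homogeneous component of which still
    separates [w0]. *)
Theorem has_invariant_hypersurface w0 : (0 < e)%N -> ~ has_invariant w0 ->
  exists k (P : {mpoly K[\dim {:H0 K d}]}), [/\ P \is k.-homog,
    forall w, has_invariant w -> P.@[fun i => coord (vbasis {:H0 K d}) i w] = 0 &
    P.@[fun i => coord (vbasis {:H0 K d}) i w0] != 0].
Proof.
move=> e0 w0n; pose co w := fun i => coord (vbasis {:H0 K d}) i w.
have [|Q [P PE] [Q0 QP]] := @elimination_kernel K (H0 K d) (@polyfun K (H0 K d))
  (@polyfun_cst _ _) (@polyfunD _ _) (@polyfunM _ _) _ _ _ incidence_mx w0 dim_dhomog_gt0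
  incidence_polyfun.
  move=> y u [i yi] uM; apply: contrapT => /eqP u0; apply: w0n.
  pose F := \sum_k u 0 k *: fU k; pose Theta ij := \sum_l y (lift ord0 l) *: fW l ij.
  have FT i' j' : y ord0 *: wedge (differential F) (component w0) i' j' = F * Theta (i', j').
    exact: incidence_mx_ker e0 uM.
  have F0 : F != 0 by apply: contraNneq u0 => /basis_dhomog_free u0; apply/eqP/rowP => k; rewrite u0 mxE.
  (* If the homogenising coordinate were zero, [F * Theta = 0] would force [Theta = 0], hence
     [y = 0]. So one may divide by it. *)
  have y0 : y ord0 != 0.
    apply: contraNneq yi => y0; have Th0 ij : Theta ij = 0.
      by case: ij => i' j'; apply: (mulfI F0); rewrite -FT y0 scale0r mulr0.
    have yl := basis_ffun_free Th0.
    by case: (unliftP ord0 i) => [l ->|->]; rewrite ?y0 ?yl.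
  exists F, (\matrix_(i', j') ((y ord0)^-1 *: Theta (i', j'))); split=> //.
  - exact: basis_dhomog_homog.
  - move=> i' j'; rewrite mxE rpredZ // rpred_sum // => l _.
    by rewrite rpredZ // dhomog_is_dhomog.
  - by apply/matrixP => i' j'; rewrite [RHS]mxE [X in _ * X]mxE -scalerAr -FT scalerK.
(* Forms with an invariant curve are stable under nonzero scaling, so a homogeneous component can be
   extracted. *)
have [|||k [R [Rk RT R0]]] := @homogeneous_component K _ P
  (fun v => exists2 w, has_invariant w & v = co w) (co w0).
- move=> c v c0 [w hw ->]; exists (c *: w); first exact: has_invariantZ.
  by apply/funext => i; rewrite /co linearZ.
- move=> _ [w [F [T [F0 Fe Td FT]]] ->]; rewrite -PE.
  pose Th : W := [ffun ij => DHomog (Td ij.1 ij.2)].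
  (* The homogenising coordinate is normalised to 1. *)
  pose y (i : 'I_(\dim {:W}).+1) := if unlift ord0 i is Some l then coord (vbasis {:W}) l Th else 1.
  pose u := \row_k coord (vbasis {:U}) k (DHomog Fe).
  have uF : \sum_k u 0 k *: fU k = F.
    rewrite -[F]/(val (DHomog Fe)) [in RHS](coord_vbasis (memvf (DHomog Fe))) raddf_sum.
    by apply: eq_bigr => k _; rewrite mxE.
  apply: (QP w y u).
  - by exists ord0; rewrite /y unlift_none oner_eq0.
  - apply: contraNneq F0 => u0; rewrite -uF u0 big1 // => k _.
    by rewrite mxE scale0r.
  apply/rowP => c; have := incidence_mxE y u w c.
  case: (enum_val c : idx) => [ij m] ->; rewrite uF [RHS]mxE /y unlift_none scale1r.
  have -> : \sum_l (if unlift ord0 (lift ord0 l) is Some l' then coord (vbasis {:W}) l' Th else 1)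
      *: fW l ij = T ij.1 ij.2.
    rewrite (_ : T ij.1 ij.2 = val (Th ij)); last by rewrite ffunE.
    rewrite [in RHS](coord_vbasis (memvf Th)) sum_ffunE raddf_sum.
    by apply: eq_bigr => l _; rewrite liftK ffunE.
  by move/matrixP: FT => ->; rewrite mxE subrr mcoeff0.
- by rewrite -PE.
by exists k, R; split=> // w hw; apply: RT; exists w.
Qed.

End InvariantCurvesOfGivenDegree.

(** * The countable union of hypersurfaces *)

Lemma line_eq (K : fieldType) (V : vectType K) (v w : V) :
  v != 0 -> <[v]>%VS = <[w]>%VS -> exists2 c, c != 0 & v = c *: w.
Proof.
move=> v0 vw; have /vlineP[c vE] : v \in <[w]>%VS by rewrite -vw memv_line.
by exists c => //; apply: contraNneq v0 => c0; rewrite vE c0 scale0r.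
Qed.

Theorem theorem3 (R : realType) (d : nat) (d_ge2 : (2 <= d)%N)
    (d_odd : odd d) (d_mod3 : d <> 1 %[mod 3]) :
  exists Z : nat -> set {vspace H0 R[i] d},
    (forall n : nat,
        zariski_closed_in (foliations R[i] d) (Z n) /\
        Z n `<` foliations R[i] d) /\
    (forall w : H0 R[i] d, defines_foliation w ->
        ~ (\bigcup_n Z n) <[w]>%VS ->
        ~ exists F : {mpoly R[i][3]}, invariant_curve w F).
Proof.
pose co (w : H0 R[i] d) := fun i => coord (vbasis {:H0 R[i] d}) i w.
(* Curves have positive degree, so index [n] accounts for degree [n.+1]. *)
have hyp n : exists P : {mpoly R[i][\dim {:H0 R[i] d}]},
    [/\ exists k, P \is k.-homog,
        forall w, has_invariant n.+1 w -> P.@[co w] = 0 &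
        P.@[co (jouanolou R[i] d)] != 0].
  have [|k [P [Pk PT P0]]] := @has_invariant_hypersurface R[i] d n.+1 (jouanolou R[i] d) isT.
    by case=> F [T [F0 Fe Td FT]]; exact: (jouanolou_no_invariant d_ge2 (ltn0Sn n) F0 Fe Td FT).
  by exists P; split=> //; exists k.
have [P PP] := choice hyp.
pose Y n := proj_set [set v : H0 R[i] d | forall Q, [set P n] Q -> Q.@[co v] = 0].
exists (fun n => foliations R[i] d `&` Y n); split=> [n|w [w0 wfin] wZ [F wF]].
  have [[k Pk] PT P0] := PP n; split.
    by exists (Y n) => //; exists [set P n] => // _ ->; exists k.
  split; first by move=> L [].
  (* Properness: the foliation of Jouanolou is not in [Y n]. Membership provides only some
     representative [v] of its line, and homogeneity carries the vanishing of [P n] over to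
     [jouanolou]. *)
  move=> sub; have [|_ [v [v0 /(_ _ erefl) Pv]]] := sub <[jouanolou R[i] d]>%VS.
    by exists (jouanolou R[i] d) => //; split; [exact: jouanolou_neq0|exact: jouanolou_foliation].
  move=> vj; have [c c0 jE] := line_eq (jouanolou_neq0 R[i] d) (esym vj).
  move/eqP: P0; apply; rewrite jE.
  rewrite (meval_eq (v2 := fun i => c * co v i)) => [|i]; last by rewrite /co linearZ.
  by rewrite (meval_homog _ _ Pk) Pv mulr0.
have [[F0 [e e0 Fe] _] _] := wF; apply: wZ; exists e.-1 => //; split.
  by exists w => //; split.
exists w => //; split=> // _ ->.
have [_ PT _] := PP e.-1; apply: PT; rewrite prednK //.
exact: invariant_curve_has_invariant wF.
Qed.
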